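(* Let $\lambda$ be an infinite cardinal, $\theta$ an infinite regular cardinal and $\chi$ either $2$ or an infinite cardinal, and suppose $\chi\le\theta<\lambda$ and $\theta\neq\mathrm{cf}(\lambda)$. Then the following are equivalent: (1) $\{S\in I[\lambda^+]\mid S\subseteq E^{\lambda^+}_\theta\}\subseteq J_\chi[\lambda^+]$; (2) $J_\chi[\lambda^+]$ contains a stationary subset of $E^{\lambda^+}_\theta$; (3) $m(\theta,\lambda,\theta,\chi)=\lambda$; (4) $m(\lambda,\lambda,\theta,\chi)=\lambda$.
   Context: $E^\kappa_\theta=\{\alpha<\kappa\mid\mathrm{cf}(\alpha)=\theta\}$. For a set $\Delta$ with $|\Delta|\ge\theta$, $m(\Delta,\lambda,\theta,\chi)$ is the least size of a family $\mathcal H$ of functions from $\Delta$ to $[\lambda]^{<\chi}$ such that for every $X\in[\Delta]^\theta$ and every $g:X\to\lambda$ there is $h\in\mathcal H$ with $|\{\xi\in X\mid g(\xi)\in h(\xi)\}|=\theta$. For regular uncountable $\kappa$, $J_\chi[\kappa]$ is the collection of all $S\subseteq\kappa$ for which there exist a club $C\subseteq\kappa$ and functions $f_i:\kappa\to[\kappa]^{<\chi}$ ($i<\kappa$) such that for every $\alpha\in S\cap C$, every regressive $f:\alpha\to\alpha$ and every cofinal $B\subseteq\alpha$, there is $i<\alpha$ with $\sup\{\beta\in B\mid f(\beta)\in f_i(\beta)\}=\alpha$. $I[\kappa]$ is Shelah's approachability ideal: $S\in I[\kappa]$ iff there are a sequence $\langle a_\beta\mid\beta<\kappa\rangle$ of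 bounded subsets of $\kappa$ and a club $C\subseteq\kappa$ such that each $\alpha\in S\cap C$ has a cofinal $A\subseteq\alpha$ of order type $\mathrm{cf}(\alpha)$ with $\{A\cap\gamma\mid\gamma<\alpha\}\subseteq\{a_\beta\mid\beta<\alpha\}$. *)

(* Defs.v *)
(* A self-contained, honest development of the ordinal /
   cardinal notions needed for Theorem 3.7: we work inside an arbitrary
   well-ordered type O whose order type is kappa = lambda^+; all the
   cardinals lambda, theta, chi (< lambda^+) are elements of O, and an
   ordinal alpha < kappa is identified with its initial segment seg alpha. *)
From Stdlib Require Import Classical.

Definition le_card {X Y : Type} (A : X -> Prop) (B : Y -> Prop) : Prop :=
  exists f : {x | A x} -> {y | B y}, forall u v, f u = f v -> u = v.
Definition eq_card {X Y : Type} (A : X -> Prop) (B : Y -> Prop) : Prop :=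
  exists f : {x | A x} -> {y | B y},
    (forall u v, f u = f v -> u = v) /\ (forall w, exists u, f u = w).
Definition lt_card {X Y : Type} (A : X -> Prop) (B : Y -> Prop) : Prop :=
  le_card A B /\ ~ le_card B A.

Section Ordinals.
Context {O : Type} (lt : O -> O -> Prop).

Definition le (a b : O) : Prop := lt a b \/ a = b.

Definition well_order : Prop :=
  (forall a, ~ lt a a) /\
  (forall a b c, lt a b -> lt b c -> lt a c) /\
  (forall a b, lt a b \/ a = b \/ lt b a) /\
  well_founded lt.

Definition seg (a : O) : O -> Prop := fun b => lt b a.

Definition is_cardinal (a : O) : Prop :=
  forall b, lt b a -> ~ le_card (seg a) (seg b).

Definition infinite (a : O) : Prop :=
  exists f : nat -> O, (forall n, lt (f n) a) /\ (forall n m, f n = f m -> n = m).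

Definition is_two (a : O) : Prop :=
  exists x y, lt x y /\ forall z, lt z a <-> (z = x \/ z = y).

(* the whole of O has order type l^+ *)
Definition is_succ_card_of (l : O) : Prop :=
  is_cardinal l /\ (forall a, le_card (seg a) (seg l)) /\
  ~ le_card (fun _ : O => True) (seg l).

(* A is cofinal in a (A subset of a assumed separately) *)
Definition cofinal_in (A : O -> Prop) (a : O) : Prop :=
  forall b, lt b a -> exists c, A c /\ le b c.

Definition cof_le (a g : O) : Prop :=
  exists f : O -> O, (forall b, lt b g -> lt (f b) a) /\
    cofinal_in (fun c => exists b, lt b g /\ f b = c) a.

Definition is_cof (a g : O) : Prop :=
  cof_le a g /\ forall d, lt d g -> ~ cof_le a d.

Definition E_cof (th : O) : O -> Prop := fun a => is_cof a th.

Definition club (C : O -> Prop) : Prop :=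
  (forall b, exists c, C c /\ lt b c) /\
  (forall a, (exists b, lt b a) ->
     (forall b, lt b a -> exists c, C c /\ lt b c /\ lt c a) -> C a).

Definition stationary (S : O -> Prop) : Prop :=
  forall C, club C -> exists a, S a /\ C a.

(* sup X = a, for X a subset of a *)
Definition sup_is (X : O -> Prop) (a : O) : Prop :=
  forall g, lt g a -> exists x, X x /\ lt g x.

Definition J_ideal (ch : O) (S : O -> Prop) : Prop :=
  exists C, club C /\
  exists F : O -> O -> (O -> Prop),
    (forall i b, lt_card (F i b) (seg ch)) /\
    forall a, S a -> C a ->
    forall f : O -> O,
      (forall b, lt b a -> lt (f b) a) ->
      (forall b, lt b a -> (exists z, lt z b) -> lt (f b) b) ->
    forall B : O -> Prop,
      (forall b, B b -> lt b a) -> cofinal_in B a ->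
      exists i, lt i a /\ sup_is (fun b => B b /\ F i b (f b)) a.

Definition order_type (A : O -> Prop) (c : O) : Prop :=
  exists h : O -> O,
    (forall x y, lt x c -> lt y c -> lt x y -> lt (h x) (h y)) /\
    (forall x, lt x c -> A (h x)) /\
    (forall y, A y -> exists x, lt x c /\ h x = y).

Definition I_ideal (S : O -> Prop) : Prop :=
  exists av : O -> (O -> Prop),
    (forall b, exists g, forall x, av b x -> lt x g) /\
    exists C, club C /\
    forall al, S al -> C al ->
      exists A : O -> Prop,
        (forall x, A x -> lt x al) /\ cofinal_in A al /\
        (exists c, is_cof al c /\ order_type A c) /\
        forall g, lt g al -> exists b, lt b al /\
          forall x, (A x /\ lt x g) <-> av b x.

(* H is a family of functions D -> [l]^{<ch} witnessing the covering
   property in the definition of m(D, l, th, ch) *)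
Definition m_family (D : O -> Prop) (l th ch : O)
    (H : (O -> O -> Prop) -> Prop) : Prop :=
  (forall h, H h -> forall x, D x ->
      (forall y, h x y -> lt y l) /\ lt_card (h x) (seg ch)) /\
  forall X : O -> Prop, (forall x, X x -> D x) -> eq_card X (seg th) ->
  forall g : O -> O, (forall x, X x -> lt (g x) l) ->
    exists h, H h /\ eq_card (fun x => X x /\ h x (g x)) (seg th).

Definition m_is (D : O -> Prop) (l th ch v : O) : Prop :=
  (exists H, m_family D l th ch H /\ eq_card H (seg v)) /\
  (forall H, m_family D l th ch H -> le_card (seg v) H).

End Ordinals.

(* Main.v *)
(** Write [kappa = lambda^+].  For (1) => (2) one needs a stationary set of approachable
    points of cofinality [theta] (Shelah).  If [lambda = theta^+], every point of
    cofinality [theta] is approachable: fix injections [e_d : d -> lambda]; for some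
    [i < lambda] the trace [{x < d | e_d x < i}] is cofinal in [d] and its initial segments
    are again traces.  Otherwise let [mu = theta^{++} <= lambda], take a club-guessing
    sequence on the points of [mu] of cofinality [theta], and build an increasing
    [mu]-sequence in which each step reflects below itself whatever its supremum
    knows about the guessed index sets.

    (2) => (3): read the functions [f_i], [i < a], along a cofinal [theta]-sequence of one
    point [a > lambda] of the stationary set.  (3) => (4): a set of size [theta] in [lambda]
    has [theta] many elements below some [nu] of cofinality [theta]; as [cf lambda <> theta],
    [nu < lambda], so it suffices to compose the family with one level function
    [nu -> theta] for each such [nu].

    (4) => (1): for [i < lambda] let [hull i] be the transitive closure of "x is among the
    first i points of y, or lies in a small a_j indexed by one of them".  Each [y] has fewer
    than [lambda] predecessors, so [kappa] has a colouring by [lambda] that is injective on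
    [hull i]-chains.  Approachability and [cf lambda <> theta] make a cofinal part of
    any cofinal [B] a [hull i]-chain for some [i]; composing the colouring with the
    family of (4) gives the functions witnessing [J]. *)
Require Import Defs.
From Stdlib Require Import Classical ClassicalEpsilon FunctionalExtensionality ssreflect.
From Stdlib Require Import Relation_Operators Lexicographic_Product Inverse_Image Cantor Lia.

(** * Cardinality of predicates *)

Lemma choice_on {X Y : Type} (y0 : Y) (A : X -> Prop) (R : X -> Y -> Prop) :
  (forall x, A x -> exists y, R x y) -> exists f, forall x, A x -> R x (f x).
Proof.
move=> H; exists (fun x => epsilon (inhabits y0) (R x)) => x Ax.
exact: epsilon_spec (H x Ax).
Qed.

(** [le_card] through total functions, which compose and restrict without subtypes; the passage from
    [le_card] to [emb] takes a default point [y0] of the target type. *)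
Definition emb {X Y : Type} (A : X -> Prop) (B : Y -> Prop) : Prop :=
  exists f : X -> Y, (forall x, A x -> B (f x)) /\
    (forall x y, A x -> A y -> f x = f y -> x = y).

Definition prodP {X Y : Type} (A : X -> Prop) (B : Y -> Prop) : X * Y -> Prop :=
  fun p => A (fst p) /\ B (snd p).

Lemma sig_eq {X : Type} {A : X -> Prop} (u v : {x | A x}) :
  proj1_sig u = proj1_sig v -> u = v.
Proof.
case: u v => [x a] [y b] /= E; subst y; by rewrite (proof_irrelevance _ a b).
Qed.

Lemma emb_le_card {X Y : Type} (A : X -> Prop) (B : Y -> Prop) :
  emb A B -> le_card A B.
Proof.
case=> f [fB fI].
exists (fun u => exist B (f (proj1_sig u)) (fB _ (proj2_sig u))) => u v E.
apply: sig_eq; apply: fI; [exact: proj2_sig|exact: proj2_sig|].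
by case: E.
Qed.

Lemma le_card_emb {X Y : Type} (y0 : Y) (A : X -> Prop) (B : Y -> Prop) :
  le_card A B -> emb A B.
Proof.
case=> f fI.
have H x : A x -> exists y, exists a : A x, y = proj1_sig (f (exist _ x a)).
  by move=> a; exists (proj1_sig (f (exist _ x a))), a.
have [g gP] := choice_on y0 _ _ H.
exists g; split=> [x /gP [a ->]|x y /gP [a ->] /gP [b ->] E]; first exact: proj2_sig.
have := fI _ _ (sig_eq _ _ E); by case.
Qed.

Lemma emb_incl {X : Type} (A B : X -> Prop) : (forall x, A x -> B x) -> emb A B.
Proof. by move=> H; exists (fun x => x). Qed.

Lemma emb_trans {X Y Z : Type} (A : X -> Prop) (B : Y -> Prop) (C : Z -> Prop) :
  emb A B -> emb B C -> emb A C.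
Proof.
case=> f [fB fI] [g [gC gI]]; exists (fun x => g (f x)); split; first by auto.
move=> x y Ax Ay E; apply: fI => //; apply: gI; auto.
Qed.

Lemma emb_sub {X Y : Type} (A A' : X -> Prop) (B : Y -> Prop) :
  (forall x, A x -> A' x) -> emb A' B -> emb A B.
Proof. move=> H; apply: emb_trans; exact: emb_incl. Qed.

Lemma emb_prod {X Y X' Y' : Type} (A : X -> Prop) (B : Y -> Prop)
    (A' : X' -> Prop) (B' : Y' -> Prop) :
  emb A A' -> emb B B' -> emb (prodP A B) (prodP A' B').
Proof.
case=> f [fB fI] [g [gC gI]]; exists (fun p => (f (fst p), g (snd p))); split.
  by move=> [x y] [/= a b]; split=> /=; auto.
move=> [x y] [x' y'] [/= a b] [/= a' b'] [E E'].
by rewrite (fI _ _ a a' E) (gI _ _ b b' E').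
Qed.

Lemma emb_cover {X Y : Type} (y0 : Y) (A : X -> Prop) (B : Y -> Prop) (R : Y -> X -> Prop) :
  (forall x, A x -> exists y, B y /\ R y x) ->
  (forall y x x', R y x -> R y x' -> x = x') -> emb A B.
Proof.
move=> H U.
have [f fP] := choice_on y0 A (fun x y => B y /\ R y x) H.
exists f; split=> [x /fP []|x x' /fP [_ h] /fP [_ h'] E] //.
by rewrite -E in h'; apply: U h h'.
Qed.

Lemma emb_image {X Y : Type} (y0 : Y) (B : Y -> Prop) (g : Y -> X) (A : X -> Prop) :
  (forall x, A x -> exists y, B y /\ g y = x) -> emb A B.
Proof.
move=> H; by apply: (emb_cover y0 _ _ (fun y x => g y = x)) => // y x x' <-.
Qed.

Lemma emb_enum {X Y : Type} (A : X -> Prop) (B : Y -> Prop) (a0 : X) :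
  A a0 -> emb A B ->
  exists g : Y -> X, (forall y, A (g y)) /\ (forall a, A a -> exists y, B y /\ g y = a).
Proof.
move=> Aa0 [f [fB fI]].
have H y : True -> exists x, A x /\ ((exists a, A a /\ f a = y) -> f x = y).
  move=> _; case: (classic (exists a, A a /\ f a = y)) => [[a [Aa E]]|N].
    by exists a.
  by exists a0; split=> // E; case: N.
have [g gP] := choice_on a0 (fun _ => True) _ H.
exists g; split=> [y|a Aa]; first by case: (gP y I).
exists (f a); split; first exact: fB.
have [Ag E] := gP (f a) I; apply: fI => //; apply: E; by exists a.
Qed.

(** The points of [A] reached by iterating [g] after [f] from points of [A] outside [g(B)]: the
    bijection is [f] on them and the inverse of [g] elsewhere. *)
Inductive cb_chain {X Y : Type} (A : X -> Prop) (B : Y -> Prop) (f : X -> Y) (g : Y -> X) :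
    X -> Prop :=
| cb_base x : A x -> (forall y, B y -> g y <> x) -> cb_chain A B f g x
| cb_step x : cb_chain A B f g x -> cb_chain A B f g (g (f x)).

Lemma cantor_bernstein {X Y : Type} (A : X -> Prop) (B : Y -> Prop) :
  emb A B -> emb B A -> eq_card A B.
Proof.
move=> [f [fB fI]] [g [gA gI]].
pose ch := cb_chain A B f g.
have chA x : ch x -> A x by elim=> // {}x _ Ax; auto.
have [h hP] : exists h : {x | A x} -> {y | B y}, forall u : {x | A x}, True ->
    (ch (proj1_sig u) /\ proj1_sig (h u) = f (proj1_sig u)) \/
    (~ ch (proj1_sig u) /\ g (proj1_sig (h u)) = proj1_sig u).
  case: (classic (exists y, B y)) => [[y0 By0]|N]; last first.
    have F (u : {x | A x}) : False by apply: N; exists (f (proj1_sig u)); apply: fB; exact: proj2_sig.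
    by exists (fun u : {x | A x} => False_rect _ (F u)) => u.
  apply: (choice_on (exist B y0 By0) (fun _ => True)
    (fun u v => (ch (proj1_sig u) /\ proj1_sig v = f (proj1_sig u)) \/
    (~ ch (proj1_sig u) /\ g (proj1_sig v) = proj1_sig u))) => -[x Ax] _ /=.
  case: (classic (ch x)) => c; first by exists (exist B (f x) (fB _ Ax)); left.
  case: (classic (exists y, B y /\ g y = x)) => [[y [By E]]|M].
    by exists (exist B y By); right.
  case: c; apply: cb_base => // y By E; apply: M; by exists y.
exists h; split.
  move=> [x Ax] [x' Ax'] E; apply: sig_eq => /=.
  have [[/= c e]|[/= c e]] := hP (exist A x Ax) I;
    have [[/= c' e']|[/= c' e']] := hP (exist A x' Ax') I; rewrite ?E in e.
  - by apply: fI => //; rewrite -e e'.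
  - have q : x' = g (f x) by rewrite -e e'.
    by case: c'; rewrite q; exact: cb_step.
  - have q : x = g (f x') by rewrite -e' e.
    by case: c; rewrite q; exact: cb_step.
  - by rewrite -e e'.
  - move=> [y By]; case: (classic (ch (g y))) => c.
      have [x [cx E]] : exists x, ch x /\ f x = y.
        remember (g y) as z eqn:Ez; case: c Ez => [x Ax N|x cx] Ez; first by case: (N y).
        by exists x; split=> //; apply: gI => //; apply: fB; apply: chA.
      exists (exist A x (chA _ cx)); apply: sig_eq.
      by have [[/= _ ->]|[]] := hP (exist A x (chA _ cx)) I.
    exists (exist A (g y) (gA _ By)); apply: sig_eq => /=.
    have [[]|[/= _ E]] // := hP (exist A (g y) (gA _ By)) I.
    apply: gI E => //; exact: proj2_sig.
Qed.

Lemma eq_card_emb {X Y : Type} (y0 : Y) (A : X -> Prop) (B : Y -> Prop) :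
  eq_card A B -> emb A B.
Proof. case=> f [fI _]; apply: (le_card_emb y0); by exists f. Qed.

Lemma eq_card_emb_sym {X Y : Type} (x0 : X) (A : X -> Prop) (B : Y -> Prop) :
  eq_card A B -> emb B A.
Proof.
case=> f [fI fS].
apply: (emb_cover x0 _ _ (fun x y => exists a : A x, proj1_sig (f (exist _ x a)) = y)).
  move=> y By; have [[x a] E] := fS (exist B y By).
  by exists x; split=> //; exists a; rewrite E.
by move=> x y y' [a <-] [a' <-]; rewrite (proof_irrelevance _ a a').
Qed.

(** Values are picked by [epsilon] along [Fix]. The second hypothesis says that [R i] sees only the
    values of [f] below [i]; a value must exist only when all earlier choices were admissible. *)
Lemma rec_choice {W T : Type} (r : W -> W -> Prop) (t0 : T) (R : W -> (W -> T) -> T -> Prop) :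
  well_founded r ->
  (forall i f f' y, (forall j, r j i -> f j = f' j) -> R i f y -> R i f' y) ->
  (forall i f, (forall j, r j i -> R j f (f j)) -> exists y, R i f y) ->
  exists f, forall i, R i f (f i).
Proof.
move=> wf ext H.
pose tr i (g : forall j, r j i -> T) j :=
  match excluded_middle_informative (r j i) with left p => g j p | right _ => t0 end.
pose F i (g : forall j, r j i -> T) := epsilon (inhabits t0) (R i (tr i g)).
pose f := Fix wf (fun _ => T) F.
have E i : f i = epsilon (inhabits t0) (R i (tr i (fun j _ => f j))).
  rewrite /f Fix_eq // => x g g' e; rewrite /F; congr (epsilon _ (R x _)).
  apply: functional_extensionality => j; rewrite /tr.
  by case: (excluded_middle_informative _).
exists f; elim/(well_founded_ind wf) => i IH.
have tE j : r j i -> f j = tr i (fun j _ => f j) j.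
  by rewrite /tr; case: (excluded_middle_informative _).
rewrite E; apply: (ext i (tr i (fun j _ => f j))); first by move=> j /tE.
apply: epsilon_spec; have [y Ry] := H i f IH.
by exists y; apply: ext Ry.
Qed.

(** Send each [w] to a point of [A] not taken by its predecessors. The recursion stalls only if the
    predecessors exhaust [A], and then [A] embeds into them. *)
Lemma greedy {W X : Type} (r : W -> W -> Prop) (P : W -> Prop) (A : X -> Prop) (x0 : X) :
  well_founded r -> (forall a b, r a b \/ a = b \/ r b a) ->
  (forall w, P w -> ~ emb A (fun v => r v w /\ P v)) -> emb P A.
Proof.
move=> wf tri H.
have [f fP] : exists f : W -> X, forall w, P w -> A (f w) /\ forall v, r v w -> P v -> f v <> f w.
  apply: (rec_choice r x0 (fun w f x => P w -> A x /\ forall v, r v w -> P v -> f v <> x)) => //.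
    move=> i f f' y E h Pi; case: (h Pi) => Ay N; split=> // v vi Pv; rewrite -E //; exact: N.
  move=> w f IH; case: (classic (P w)) => Pw; last by exists x0.
  apply: NNPP => N; apply: (H w Pw).
  apply: (emb_image w _ f) => x Ax; apply: NNPP => M; apply: N; exists x => _; split=> // v vw Pv E.
  by apply: M; exists v.
exists f; split=> [w /fP []|v w Pv Pw E] //.
case: (tri v w) => [h|[//|h]]; first by case: (fP w Pw) => _ /(_ v h Pv) /(_ E).
by case: (fP v Pv) => _ /(_ w h Pw); rewrite E.
Qed.

(** * Well-orders, cardinals and cofinality *)

Definition inf {X : Type} (A : X -> Prop) : Prop := emb (fun _ : nat => True) A.

(** Hilbert's hotel: moving one place along a copy of the natural numbers inside [B] frees the point
    [b0]. *)
Lemma inf_shift {Y : Type} (B : Y -> Prop) : inf B ->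
  exists sh b0, B b0 /\ (forall y, B y -> B (sh y) /\ sh y <> b0) /\
    (forall y y', B y -> B y' -> sh y = sh y' -> y = y').
Proof.
case=> n [nB nI].
have H y : B y -> exists z, (exists k, y = n k /\ z = n (S k)) \/ ((forall k, y <> n k) /\ z = y).
  move=> By; case: (classic (exists k, y = n k)) => [[k ->]|N].
    by exists (n (S k)); left; exists k.
  by exists y; right; split=> // k E; apply: N; exists k.
have nE k k' : n k = n k' -> k = k' by exact: nI.
have [sh shP] := choice_on (n 0) _ _ H.
exists sh, (n 0); split; first exact: nB.
split=> [y By|y y' By By' E].
  case: (shP y By) => [[k [_ ->]]|[N ->]]; last by split=> //; exact: N.
  by split; [exact: nB|move/nE].
case: (shP y By) => [[k [Ey e]]|[N e]]; case: (shP y' By') => [[k' [Ey' e']]|[N' e']].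
- by rewrite Ey Ey'; move: E; rewrite e e' => /nE [->].
- by case: (N' (S k)); rewrite -e -e'.
- by case: (N (S k')); rewrite -e -e'.
- by rewrite -e -e'.
Qed.

Lemma emb_add {X Y : Type} (A : X -> Prop) (B : Y -> Prop) (p : X) :
  inf B -> emb A B -> emb (fun x => A x \/ x = p) B.
Proof.
move=> /inf_shift [sh [b0 [Bb0 [shB shI]]]] [f [fB fI]].
pose R y x := (A x /\ y = sh (f x)) \/ (~ A x /\ x = p /\ y = b0).
apply: (emb_cover b0 _ _ R).
  move=> x H; case: (classic (A x)) => Ax.
    by exists (sh (f x)); split; [case: (shB _ (fB x Ax))|left].
  by exists b0; split=> //; right; split=> //; case: H.
move=> y x x' [[Ax E]|[Ax [-> E]]] [[Ax' E']|[Ax' [-> E']]] //.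
- by apply: fI => //; apply: shI; [exact: fB|exact: fB|rewrite -E -E'].
- by case: (shB _ (fB x Ax)) => _; rewrite -E E'.
- by case: (shB _ (fB x' Ax')) => _; rewrite -E' E.
Qed.

Lemma inf_del {X : Type} (A : X -> Prop) (p : X) : inf (fun x => A x \/ x = p) -> inf A.
Proof.
case=> f [fA fI].
case: (classic (exists k, f k = p)) => [[k E]|N].
  exists (fun n => f (n + S k)); split=> [n _|n m _ _ e].
    case: (fA (n + S k) I) => // e; have := fI (n + S k) k I I; rewrite e E => /(_ eq_refl); lia.
  have := fI _ _ I I e; lia.
exists f; split=> [n _|n m _ _ e]; last exact: fI.
by case: (fA n I) => // e; case: N; exists n.
Qed.

Lemma emb_nat_or_inf {X : Type} (x0 : X) (A : X -> Prop) :
  inf A \/ emb A (fun _ : nat => True).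
Proof.
case: (classic (emb A (fun _ : nat => True))) => H; first by right.
left; apply: (greedy Peano.lt _ _ x0); [exact: Wf_nat.lt_wf|move=> a b; lia|].
move=> w _ [f [_ fI]]; apply: H; by exists f.
Qed.

Lemma emb_union_prod {I X Y : Type} (y0 : Y) (A : I -> Prop) (B : I -> X -> Prop) (C : Y -> Prop) :
  emb A C -> (forall i, A i -> emb (B i) C) ->
  emb (fun x => exists i, A i /\ B i x) (prodP C C).
Proof.
move=> [a [aC aI]] H.
have [f fP] := choice_on (fun _ => y0) _ _ H.
apply: (emb_cover (y0, y0) _ _ (fun p x => exists i, A i /\ B i x /\ p = (a i, f i x))).
  move=> x [i [Ai Bx]]; exists (a i, f i x); split; last by exists i.
  by split=> /=; [exact: aC|case: (fP i Ai) => h _; exact: h].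
move=> p x x' [i [Ai [Bx ->]]] [j [Aj [Bx' [/aI E e]]]].
have ij := E Ai Aj; subst j; case: (fP i Ai) => _; exact.
Qed.

Section Order.
Context {O : Type} {lt : O -> O -> Prop} (WO : well_order lt).
Local Notation le := (Defs.le lt).
Local Notation seg := (Defs.seg lt).

Lemma lt_irr a : ~ lt a a. Proof. by case: WO. Qed.
Lemma lt_tr b a c : lt a b -> lt b c -> lt a c.
Proof. case: WO => _ [h _]; exact: h. Qed.
Lemma lt_tri a b : lt a b \/ a = b \/ lt b a. Proof. by case: WO => _ [_ []]. Qed.
Lemma lt_wf : well_founded lt. Proof. by case: WO => _ [_ []]. Qed.
Lemma le_refl a : le a a. Proof. by right. Qed.
Lemma lt_le a b : lt a b -> le a b. Proof. by left. Qed.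
Lemma le_lt b a c : le a b -> lt b c -> lt a c.
Proof. case=> [|->] //; exact: lt_tr. Qed.
Lemma lt_le_tr b a c : lt a b -> le b c -> lt a c.
Proof. move=> h [|<-] //; exact: lt_tr. Qed.
Lemma le_tr b a c : le a b -> le b c -> le a c.
Proof. move=> h [|<-] // h'; left; exact: le_lt h h'. Qed.
Lemma nlt_le a b : ~ lt a b -> le b a.
Proof. by case: (lt_tri a b) => [//|[-> _|h _]]; [right|left]. Qed.
Lemma le_nlt a b : le b a -> ~ lt a b.
Proof. move=> h h'; exact: (lt_irr b) (le_lt _ _ _ h h'). Qed.
Lemma le_or_lt a b : le a b \/ lt b a.
Proof. case: (classic (lt b a)) => [|/nlt_le]; by [right|left]. Qed.

Lemma least (P : O -> Prop) : (exists x, P x) -> exists x, P x /\ forall y, P y -> le x y.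
Proof.
move=> [x Px]; apply: NNPP => N.
elim/(well_founded_ind lt_wf): x Px => x IH Px; apply: N; exists x; split=> // y Py.
by apply: nlt_le => /IH /(_ Py).
Qed.

Lemma max2 (a b : O) : exists c, le a c /\ le b c /\ (c = a \/ c = b).
Proof.
case: (le_or_lt a b) => h; [exists b|exists a].
  by split=> //; split; [exact: le_refl|right].
by split; [exact: le_refl|split; [exact: lt_le|left]].
Qed.

Definition closed_down (P : O -> Prop) : Prop := forall a b, P b -> lt a b -> P a.

Lemma seg_closed a : closed_down (seg a).
Proof. move=> x y h h'; exact: lt_tr h' h. Qed.

(** Comparability of cardinals: the greedy map of [P] into [A] is total unless it stalls at some
    [b], and then [A] embeds below [b]. *)
Lemma emb_total {X : Type} (P : O -> Prop) (A : X -> Prop) (x0 : X) :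
  closed_down P -> emb P A \/ exists b, P b /\ emb A (seg b).
Proof.
move=> cP; case: (classic (exists b, P b /\ emb A (seg b))) => H; [by right|left].
apply: (greedy lt _ _ x0); [exact: lt_wf|exact: lt_tri|].
move=> w Pw E; apply: H; exists w; split=> //; apply: emb_trans E _.
by apply: emb_incl => v [].
Qed.

Lemma emb_seg a b : le a b -> emb (seg a) (seg b).
Proof. move=> h; apply: emb_incl => x xa; exact: lt_le_tr xa h. Qed.

Lemma emb_le_seg {Y : Type} (B : Y -> Prop) a :
  inf B -> emb (seg a) B -> emb (fun x => le x a) B.
Proof. exact: emb_add. Qed.

(** * Squares of infinite cardinals *)

Definition omax (p : O) (q : O) : O :=
  match excluded_middle_informative (lt p q) with left _ => q | right _ => p end.

Lemma omax_ub p q : le p (omax p q) /\ le q (omax p q).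
Proof.
rewrite /omax; case: (excluded_middle_informative _) => h.
  by split; [left|right].
by split; [right|apply: nlt_le].
Qed.

Lemma omax_lt p q a : lt p a -> lt q a -> lt (omax p q) a.
Proof. by rewrite /omax; case: (excluded_middle_informative _). Qed.

Lemma slex_tri {A B : Type} (r : A -> A -> Prop) (s : B -> B -> Prop) :
  (forall a b, r a b \/ a = b \/ r b a) -> (forall a b, s a b \/ a = b \/ s b a) ->
  forall p q, slexprod A B r s p q \/ p = q \/ slexprod A B r s q p.
Proof.
move=> R S [a b] [a' b'].
case: (R a a') => [h|[<-|h]]; [by left; left| |by right; right; left].
by case: (S b b') => [h|[<-|h]]; [left; right|right; left|right; right; right].
Qed.

(** Hessenberg's theorem by Goedel's ordering of pairs: the predecessors of a pair with maximum [m]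
    lie in the square of [m + 1], which is countable or, by induction, no larger than [m]. *)
Theorem sq_emb a : inf (seg a) -> emb (prodP (seg a) (seg a)) (seg a).
Proof.
have natsq (X : Type) (A : X -> Prop) (B : X -> Prop) :
    emb A (fun _ : nat => True) -> emb B (fun _ : nat => True) ->
    emb (prodP A B) (fun _ : nat => True).
  move=> eA eB; apply: emb_trans (emb_prod _ _ _ _ eA eB) _.
  exists Cantor.to_nat; split=> // p q _ _ E.
  by rewrite -(cancel_of_to p) -(cancel_of_to q) E.
elim/(well_founded_ind lt_wf): a => a IH infa.
case: (classic (emb (seg a) (fun _ : nat => True))) => [c|nc].
  apply: emb_trans (natsq _ _ _ c c) infa.
case: (classic (exists b, lt b a /\ emb (seg a) (seg b))) => [[b [ba e]]|card].
  apply: emb_trans (emb_prod _ _ _ _ e e) _.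
  apply: emb_trans (IH b ba (emb_trans _ _ _ infa e)) _.
  by apply: emb_seg; left.
(* Here [a] is an uncountable cardinal. Pairs are ordered by maximum first, then
   lexicographically. *)
pose key (p : O * O) := (omax (fst p) (snd p), p).
pose r p q := slexprod _ _ lt (slexprod _ _ lt lt) (key p) (key q).
apply: (greedy r _ _ a).
- apply: wf_inverse_image; apply: wf_slexprod; first exact: lt_wf.
  apply: wf_slexprod; exact: lt_wf.
- move=> p q; have [h|[h|h]] := slex_tri lt (slexprod _ _ lt lt) lt_tri
    (slex_tri _ _ lt_tri lt_tri) (key p) (key q); [by left| |by right; right].
  by right; left; case: h.
- move=> p [pa qa] E.
  pose m := omax (fst p) (snd p).
  have ma : lt m a by exact: omax_lt.
  have E' : emb (seg a) (prodP (fun x => le x m) (fun x => le x m)).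
    apply: emb_trans E _; apply: emb_incl => v [h _].
    have vm : le (omax (fst v) (snd v)) m.
      rewrite /r /key in h; inversion h; [by left|by right].
    have [v1 v2] := omax_ub (fst v) (snd v).
    by split; apply: le_tr vm.
  case: (emb_nat_or_inf a (seg m)) => [i|c].
    have e : emb (fun x => le x m) (seg m) by apply: emb_le_seg => //; exact: emb_incl.
    apply: card; exists m; split=> //; apply: emb_trans E' _.
    apply: emb_trans (emb_prod _ _ _ _ e e) _; exact: IH.
  have e : emb (fun x => le x m) (fun _ : nat => True).
    by apply: emb_le_seg => //; exact: emb_incl.
  exact: nc (emb_trans _ _ _ E' (natsq _ _ _ e e)).
Qed.

Lemma emb_union {I X : Type} (A : I -> Prop) (B : I -> X -> Prop) nu :
  inf (seg nu) -> emb A (seg nu) -> (forall i, A i -> emb (B i) (seg nu)) ->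
  emb (fun x => exists i, A i /\ B i x) (seg nu).
Proof.
move=> i a b; apply: emb_trans (emb_union_prod nu _ _ _ a b) _; exact: sq_emb.
Qed.

Lemma inf_infinite a : infinite lt a <-> inf (seg a).
Proof.
split=> [[f [fa fI]]|[f [fa fI]]]; exists f.
  by split=> [n _|n m _ _]; [exact: fa|exact: fI].
by split=> [n|n m]; [exact: fa|exact: fI].
Qed.

Lemma card_nemb a b : is_cardinal lt a -> lt b a -> ~ emb (seg a) (seg b).
Proof. move=> c ba e; exact: c ba (emb_le_card _ _ e). Qed.

Lemma card_limit a : is_cardinal lt a -> inf (seg a) ->
  forall b, lt b a -> exists c, lt b c /\ lt c a.
Proof.
move=> ca ia b ba; apply: NNPP => N.
have H x : lt x a -> le x b by move=> xa; apply: nlt_le => h; apply: N; exists x.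
have ib : inf (seg b).
  apply: (inf_del _ b); apply: emb_trans ia _; by apply: emb_incl => x /H.
apply: (card_nemb a b ca ba); apply: emb_trans (emb_le_seg (seg b) b ib _); last exact: emb_incl.
by apply: emb_incl => x /H.
Qed.

Lemma cof_bound a g d f : is_cof lt a g -> lt d g -> (forall b, lt b d -> lt (f b) a) ->
  exists c, lt c a /\ forall b, lt b d -> lt (f b) c.
Proof.
move=> [_ H] dg fa; apply: NNPP => N; apply: (H d dg); exists f; split=> // b ba.
apply: NNPP => M; apply: N; exists b; split=> // x xd.
case: (le_or_lt b (f x)) => // h; case: M; exists (f x); split=> //; by exists x.
Qed.

Lemma cof_fun a g : is_cof lt a g ->
  exists f, (forall b, lt b g -> lt (f b) a) /\ forall c, lt c a -> exists b, lt b g /\ le c (f b).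
Proof.
move=> [[f [fa fc]] _]; exists f; split=> // c /fc [_ [[b [bg <-]] h]]; by exists b.
Qed.

Lemma is_cofI a g f :
  (forall b, lt b g -> lt (f b) a) -> (forall c, lt c a -> exists b, lt b g /\ le c (f b)) ->
  (forall d v, lt d g -> (forall b, lt b d -> lt (v b) a) ->
     exists c, lt c a /\ forall b, lt b d -> lt (v b) c) ->
  is_cof lt a g.
Proof.
move=> fa fc H; split.
  exists f; split=> // c /fc [b [bg h]]; exists (f b); split=> //; by exists b.
move=> d dg [v [va vc]]; have [c [ca cb]] := H d v dg va.
have [_ [[b [bd <-]] h]] := vc c ca; exact: le_nlt h (cb b bd).
Qed.

Lemma is_cof_unique a g h : is_cof lt a g -> is_cof lt a h -> g = h.
Proof.
move=> [c H] [c' H']; case: (lt_tri g h) => [/H'|[|/H]] //.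
Qed.

(** * Regular cardinals and cofinal sequences *)

Section Regular.
Context {th : O} (cth : is_cardinal lt th) (ith : inf (seg th)) (rth : is_cof lt th th).

Lemma cof_limit a : is_cof lt a th -> forall b, lt b a -> exists c, lt b c /\ lt c a.
Proof.
move=> ca b ba.
have [x [y [xy yth]]] : exists x y, lt x y /\ lt y th.
  case: ith => f [fa fI]; case: (lt_tri (f 0) (f 1)) => [h|[/(fI _ _ I I)|h]] //.
    by exists (f 0), (f 1); split=> //; exact: fa.
  by exists (f 1), (f 0); split=> //; exact: fa.
have [c [ch H]] := cof_bound a th y (fun _ => b) ca yth (fun _ _ => ba).
exists c; split=> //; exact: H x xy.
Qed.

Lemma unbounded_emb (U : O -> Prop) :
  (forall b, lt b th -> exists c, U c /\ lt c th /\ le b c) ->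
  emb (seg th) (fun c => U c /\ lt c th).
Proof.
move=> H; case: (emb_total (seg th) (fun c => U c /\ lt c th) th (seg_closed th)) => // -[b [bth e]].
have [c0 [U0 [c0th _]]] := H b bth.
have [g [gU gs]] := emb_enum _ _ c0 (conj U0 c0th) e.
have [c [cth' cb]] := cof_bound th th b g rth bth (fun x _ => proj2 (gU x)).
have [c' [Uc' [c'th h]]] := H c cth'.
have [y [yb E]] := gs c' (conj Uc' c'th).
by case: (le_nlt _ _ h); rewrite -E; exact: cb.
Qed.

Lemma emb_unbounded (U : O -> Prop) : emb (seg th) (fun c => U c /\ lt c th) ->
  forall b, lt b th -> exists c, U c /\ lt c th /\ le b c.
Proof.
move=> e b bth; apply: NNPP => N; apply: (card_nemb th b cth bth).
apply: emb_trans e _; apply: emb_incl => x [Ux xth].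
case: (le_or_lt b x) => // h; case: N; by exists x.
Qed.

(** If each of the [d] fibres of the choice [j] were bounded in [th], regularity would bound them
    all by one [c < th], yet [c] lies in a fibre itself. *)
Lemma emb_pigeon {X : Type} (d : O) (B : O -> X -> Prop) : lt d th ->
  emb (seg th) (fun x => exists j, lt j d /\ B j x) -> exists j, lt j d /\ emb (seg th) (B j).
Proof.
move=> dth [u [uB uI]]; apply: NNPP => N.
have [j jP] := choice_on th _ _ uB.
have H k : lt k d -> exists b, lt b th /\ forall z, lt z th -> j z = k -> lt z b.
  move=> kd; apply: NNPP => M; apply: N; exists k; split=> //.
  have e : emb (seg th) (fun z => j z = k /\ lt z th).
    apply: unbounded_emb => b bth; apply: NNPP => M'; apply: M; exists b; split=> // z zth E.
    case: (le_or_lt b z) => // h; case: M'; by exists z.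
  apply: emb_trans e _; exists u; split=> [z [<- zth]|z z' [_ h] [_ h']]; last exact: uI.
  by case: (jP z zth).
have [b bP] := choice_on th _ _ H.
have [c [c1 cb]] := cof_bound th th d b rth dth (fun k kd => proj1 (bP k kd)).
have [jd _] := jP c c1.
exact: lt_irr c (lt_tr _ _ _ (proj2 (bP _ jd) c c1 eq_refl) (cb _ jd)).
Qed.

Definition increasing_cofinal (s : O -> O) (a : O) : Prop :=
  (forall z, lt z th -> lt (s z) a) /\
  (forall z z', lt z' th -> lt z z' -> lt (s z) (s z')) /\
  (forall b, lt b a -> exists z, lt z th /\ le b (s z)).

Lemma cof_increasing a : is_cof lt a th -> exists s, increasing_cofinal s a.
Proof.
move=> ca; have [f [fa fc]] := cof_fun a th ca.
have [s sP] : exists s, forall z, lt z th ->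
    le (f z) (s z) /\ lt (s z) a /\ forall z', lt z' z -> lt (s z') (s z).
  apply: (rec_choice lt a
    (fun z s y => lt z th -> le (f z) y /\ lt y a /\ forall z', lt z' z -> lt (s z') y)); first exact: lt_wf.
    move=> z s s' y E h /h [h1 [h2 h3]]; split=> //; split=> // z' h'; rewrite -E //; exact: h3.
  move=> z s IH; case: (classic (lt z th)) => zth; last by exists z.
  have [c [c1 cb]] := cof_bound a th z s ca zth
    (fun b bz => proj1 (proj2 (IH b bz (lt_tr _ _ _ bz zth)))).
  have [m [m1 [m2 m3]]] := max2 (f z) c.
  exists m => _; split=> //; split; first by case: m3 => ->; auto.
  move=> z' h; exact: lt_le_tr (cb z' h) m2.
exists s; split=> [z /sP [_ []] //|]; split=> [z z' z'th h|b ba].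
  by have [_ [_ H]] := sP z' z'th; exact: H.
have [z [zth h]] := fc b ba; exists z; split=> //; case: (sP z zth) => h' _; exact: le_tr h h'.
Qed.

Lemma increasing_cof s a : increasing_cofinal s a -> is_cof lt a th.
Proof.
move=> [sa [si sc]]; apply: (is_cofI a th s) => // d v dth va.
have H b : lt b d -> exists z, lt z th /\ le (v b) (s z) by move=> /va /sc.
have [z zP] := choice_on th _ _ H.
have [c [c1 cb]] := cof_bound th th d z rth dth (fun b bd => proj1 (zP b bd)).
exists (s c); split; first exact: sa.
move=> b bd; apply: le_lt (proj2 (zP b bd)) _; apply: si => //; exact: cb.
Qed.

(** Otherwise, for each [i < lam] the values of [u] exceed [i] from some index on, so [u] tends to
    [lam]; sequences shorter than [th] are then bounded in [lam], and [lam] has cofinality [th]. *)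
Lemma bounded_on_unbounded lam u : ~ is_cof lt lam th ->
  (forall z, lt z th -> lt (u z) lam) ->
  exists i, lt i lam /\ forall b, lt b th -> exists z, lt z th /\ le b z /\ le (u z) i.
Proof.
move=> ncof ul; apply: NNPP => N; apply: ncof.
have H i : lt i lam -> exists b, lt b th /\ forall z, lt z th -> le (u z) i -> lt z b.
  move=> il; apply: NNPP => M; apply: N; exists i; split=> // b bth.
  apply: NNPP => M'; apply: M; exists b; split=> // z zth h.
  case: (le_or_lt b z) => // h'; case: M'; by exists z.
apply: (is_cofI lam th u) => // [c /H [b [bth hb]]|d v dth vl].
  exists b; split=> //; case: (le_or_lt c (u b)) => // h.
  by case: (lt_irr b); apply: hb => //; left.
apply: NNPP => M.
have H' k : lt k d -> exists b, lt b th /\ forall z, lt z th -> le (u z) (v k) -> lt z b.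
  by move=> /vl /H.
have [b bP] := choice_on th _ _ H'.
have [c [c1 cb]] := cof_bound th th d b rth dth (fun k kd => proj1 (bP k kd)).
apply: M; exists (u c); split; first exact: ul.
move=> k kd; case: (le_or_lt (u c) (v k)) => // h.
case: (lt_irr c); exact: lt_tr _ _ _ (proj2 (bP k kd) c c1 h) (cb k kd).
Qed.

(** [h] enumerates [A] in increasing order. A point of [A] missed by [h] would lie above all [th]
    values, contradicting the last hypothesis. *)
Lemma order_typeI a (A : O -> Prop) : is_cof lt a th ->
  (forall x, A x -> lt x a) -> cofinal_in lt A a ->
  (forall g, lt g a -> ~ emb (seg th) (fun x => A x /\ lt x g)) ->
  order_type lt A th.
Proof.
move=> ca Aa Ac small.
pose R z (h : O -> O) y := lt z th -> A y /\ (forall z', lt z' z -> lt (h z') y) /\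
    forall x, A x -> (forall z', lt z' z -> lt (h z') x) -> le y x.
have [h hP] : exists h, forall z, R z h (h z).
  apply: (rec_choice lt a R); first exact: lt_wf.
    move=> z h h' y E r /r [h1 [h2 h3]]; split=> //; split=> [z' l|x Ax H].
      by rewrite -E //; exact: h2.
    by apply: h3 => // z' l; rewrite E //; exact: H.
  move=> z h IH; case: (classic (lt z th)) => zth; last by exists z.
  have [c [c1 cb]] := cof_bound a th z h ca zth
     (fun b bz => Aa _ (proj1 (IH b bz (lt_tr _ _ _ bz zth)))).
  have [x [Ax cx]] := Ac c c1.
  have [y [[Ay hy] yl]] : exists y, (A y /\ (forall z', lt z' z -> lt (h z') y)) /\
      forall x, (A x /\ (forall z', lt z' z -> lt (h z') x)) -> le y x.
    apply: least; exists x; split=> // z' l; exact: lt_le_tr (cb z' l) cx.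
  exists y => _; split=> //; split=> // x' Ax' H; by apply: yl.
exists h; split; first by move=> x y _ yth xy; case: (hP y yth) => _ [H _]; exact: H.
split; first by move=> x /hP [].
move=> y Ay; apply: NNPP => N.
have H z : lt z th -> lt (h z) y.
  elim/(well_founded_ind lt_wf): z => z IH zth.
  case: (hP z zth) => _ [_ /(_ y Ay)] [z' l|//|E]; last by case: N; exists z.
  apply: IH => //; exact: lt_tr l zth.
apply: (small y (Aa y Ay)); exists h; split.
  move=> z zth; split; [by case: (hP z zth)|exact: H].
move=> z z' zth z'th E; case: (lt_tri z z') => [l|[//|l]].
  by case: (hP z' z'th) => _ [/(_ z l) q _]; case: (lt_irr (h z)); rewrite {2}E.
by case: (hP z zth) => _ [/(_ z' l) q _]; case: (lt_irr (h z)); rewrite {1}E.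
Qed.

End Regular.
End Order.

(** * Successor cardinals, clubs, and covering families *)

Section Families.
Context {O : Type} {lt : O -> O -> Prop} (WO : well_order lt).
Local Notation le := (Defs.le lt).
Local Notation seg := (Defs.seg lt).

(** [P] is an initial segment of order type nu^+. A predicate covers both the whole order, with
    [nu = lam], and the segment of a successor cardinal. *)
Definition succ_of (P : O -> Prop) (nu : O) : Prop :=
  @closed_down O lt P /\ inf (seg nu) /\ (forall b, P b -> emb (seg b) (seg nu)) /\
  ~ emb P (seg nu).

Definition club_in (P C : O -> Prop) : Prop :=
  (forall b, P b -> exists c, C c /\ P c /\ lt b c) /\
  (forall a, P a -> (exists b, lt b a) ->
     (forall b, lt b a -> exists c, C c /\ lt b c /\ lt c a) -> C a).

Section Fixed.
Context {P : O -> Prop} {nu : O} (HP : succ_of P nu).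

(** Successor cardinals are regular: were the [f i] unbounded, [P] would be a union of at most [nu]
    sets of size at most [nu]. *)
Lemma succ_bound {I : Type} (A : I -> Prop) (f : I -> O) :
  emb A (seg nu) -> (forall i, A i -> P (f i)) ->
  exists b, P b /\ forall i, A i -> lt (f i) b.
Proof.
case: HP => cP [inu [le_nu nle]] eA fP; apply: NNPP => N; apply: nle.
have H b : P b -> exists i, A i /\ le b (f i).
  move=> Pb; apply: NNPP => M; apply: N; exists b; split=> // i Ai.
  case: (le_or_lt WO b (f i)) => // h; case: M; by exists i.
apply: (emb_sub _ (fun x => exists i, A i /\ le x (f i))) => //.
apply: (emb_union WO) => // i Ai; apply: emb_le_seg => //; exact: le_nu _ (fP i Ai).
Qed.

Lemma succ_bound_le x (f : O -> O) : P x -> (forall y, P y -> P (f y)) ->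
  exists b, P b /\ lt x b /\ forall y, le y x -> lt (f y) b.
Proof.
move=> Px fP; have [cP [inu [le_nu _]]] := HP.
have e : emb (fun y => le y x) (seg nu) by apply: emb_le_seg => //; exact: le_nu.
have Py y : le y x -> P y by case=> [|-> //]; exact: cP.
have [b [Pb hb]] := succ_bound _ f e (fun y h => fP y (Py y h)).
have [c [Pc hc]] := succ_bound _ (fun y => y) e Py.
have [m [m1 [m2 m3]]] := max2 WO b c.
exists m; split; first by case: m3 => ->.
split; first by apply: (lt_le_tr WO) m2; apply: hc; right.
by move=> y /hb h; apply: (lt_le_tr WO) h m1.
Qed.

Lemma succ_gt x : P x -> exists y, P y /\ lt x y.
Proof.
move=> Px; have [b [Pb [h _]]] := succ_bound_le x (fun y => y) Px (fun _ h => h).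
by exists b.
Qed.

(** [y] is the supremum of an omega-iteration of the step from [b], so each [z < y] is overtaken by
    consecutive iterates [x], [x']. *)
Lemma iterate_sup (Q : O -> O -> Prop) :
  (forall x, P x -> exists y, P y /\ lt x y /\ Q x y) ->
  forall b, P b -> exists y, P y /\ lt b y /\
    forall z, lt z y -> exists x x', le b x /\ le z x /\ lt x x' /\ Q x x' /\ lt x' y.
Proof.
move=> H b Pb; have [g gP] := choice_on b _ _ H.
pose f := fix f n := match n with 0 => b | S n => g (f n) end.
have fP n : P (f n) by elim: n => //= n /gP [].
have [inu] : inf (seg nu) by case: HP => _ [].
move=> inu'; have [c [Pc fc]] := succ_bound (fun _ => True) f (ex_intro _ inu inu') (fun n _ => fP n).
have [y [fy yl]] : exists y, (forall n, lt (f n) y) /\ forall x, (forall n, lt (f n) x) -> le y x.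
  by apply: (least WO); exists c => n; apply: fc.
exists y; split; first by case: (yl c (fun n => fc n I)) => [h|-> //]; case: HP => cP _; exact: cP h.
split; first exact: (fy 0).
have bf n : le b (f n).
  elim: n => [|n IH]; first exact: le_refl.
  apply: le_tr IH _ => //; left; by case: (gP _ (fP n)) => _ [].
move=> z zy; apply: NNPP => N; apply: (lt_irr WO z); apply: (lt_le_tr WO) zy _.
apply: yl => n; case: (le_or_lt WO z (f n)) => // h; case: N.
exists (f n), (f (S n)); case: (gP _ (fP n)) => _ [h1 h2].
by split=> //; split=> //; split=> //; split=> //; exact: fy.
Qed.

Lemma club_inter {I : Type} (A : I -> Prop) (C : I -> O -> Prop) :
  emb A (seg nu) -> (forall i, A i -> club_in P (C i)) ->
  club_in P (fun x => forall i, A i -> C i x).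
Proof.
move=> eA HC; split; last first.
  move=> a Pa na H i Ai; apply: (proj2 (HC i Ai)) => // b /H [c [h h']]; exists c; split=> //; exact: h.
move=> b Pb.
have step x : P x -> exists y, P y /\ lt x y /\ forall i, A i -> exists c, C i c /\ lt x c /\ lt c y.
  move=> Px.
  have K i : A i -> exists c, C i c /\ P c /\ lt x c by move=> Ai; apply: (proj1 (HC i Ai)).
  have [c cP] := choice_on x _ _ K.
  have [y [Py h]] := succ_bound A c eA (fun i Ai => proj1 (proj2 (cP i Ai))).
  have [y' [Py' h']] := succ_gt x Px.
  have [m [m1 [m2 m3]]] := max2 WO y y'.
  exists m; split; first by case: m3 => ->.
  split; first exact: (lt_le_tr WO) h' m2.
  move=> i Ai; exists (c i); case: (cP i Ai) => h1 [h2 h3]; split=> //; split=> //.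
  exact: (lt_le_tr WO) (h i Ai) m1.
have [y [Py [by_ yP]]] := iterate_sup _ step b Pb.
exists y; split=> // i Ai; apply: (proj2 (HC i Ai)) => //; first by exists b.
move=> z /yP [x [x' [_ [zx [xx' [/(_ i Ai) [c [Cc [xc cx']]] x'y]]]]]].
exists c; split=> //; split; [exact: (le_lt WO) zx xc|exact: (lt_tr WO) cx' x'y].
Qed.

Lemma club_closure (g : O -> O) : (forall x, P x -> P (g x)) ->
  club_in P (fun a => forall x, lt x a -> lt (g x) a).
Proof.
move=> gP; split; last first.
  move=> a Pa _ H x /H [c [h [xc ca]]]; apply: (lt_tr WO) ca; exact: h.
move=> b Pb.
have step x : P x -> exists y, P y /\ lt x y /\ forall z, le z x -> lt (g z) y.
  by move=> Px; apply: succ_bound_le.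
have [y [Py [by_ yP]]] := iterate_sup _ step b Pb.
exists y; split=> // z /yP [x [x' [_ [zx [_ [h x'y]]]]]].
apply: (lt_tr WO) x'y; exact: h.
Qed.

End Fixed.

Lemma club_club_in C : club lt C <-> club_in (fun _ => True) C.
Proof.
split=> [[u c]|[u c]]; split.
- by move=> b _; case: (u b) => x [h h']; exists x.
- by move=> a _; exact: c.
- by move=> b; case: (u b I) => x [h [_ h']]; exists x.
- by move=> a; exact: c.
Qed.

Lemma club_tail C p : club lt C -> club lt (fun x => C x /\ lt p x).
Proof.
move=> [u c]; split=> [b|a [b ba] H].
  have [m [m1 [m2 _]]] := max2 WO b p; have [x [Cx h]] := u m.
  exists x; split; [split=> //|]; exact: (le_lt WO) _ h.
split; last by case: (H b ba) => x [[_ h] [_ xa]]; exact: (lt_tr WO) h xa.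
by apply: c; [exists b|move=> z /H [x [[h _] h']]; exists x].
Qed.

Lemma lt_card_emb {X Y Z : Type} (y0 : Y) (A : X -> Prop) (B : Y -> Prop) (C : Z -> Prop) (z0 : Z) (x0 : X) :
  emb A B -> lt_card B C -> lt_card A C.
Proof.
move=> e [h n]; split.
  apply: emb_le_card; apply: emb_trans e _; exact: le_card_emb.
move=> h'; apply: n; apply: emb_le_card; apply: emb_trans e; exact: le_card_emb.
Qed.

(** * Covering families of size lambda: (2) => (3) and (3) => (4) *)

Section Main.
Context {lam th ch : O} (clam : is_cardinal lt lam) (ilam : inf (seg lam)).
Context (slam : succ_of (fun _ => True) lam).
Context (cth : is_cardinal lt th) (ith : inf (seg th)) (rth : is_cof lt th th).
Context (chth : le ch th) (thlam : lt th lam) (ncof : ~ is_cof lt lam th).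

Lemma emb_le_lam b : emb (seg b) (seg lam).
Proof. by case: slam => _ [_ [h _]]; exact: h. Qed.

(** At each [x < th], fewer than [lam] functions with values of size below [ch <= th] leave some
    ordinal below [lam] uncovered; these ordinals form a [g] that no member of [H] catches. *)
Lemma family_size (D : O -> Prop) H : (forall x, lt x th -> D x) ->
  m_family lt D lam th ch H -> emb (seg lam) H.
Proof.
move=> Dth [Hb Hm].
case: (emb_total WO (seg lam) H (fun _ _ => False) (seg_closed WO lam)) => // -[b [bl e]].
exfalso.
have [nu [bnu [thnu nuE]]] := max2 WO b th.
have nul : lt nu lam by case: nuE => ->.
have inu : inf (seg nu) by apply: emb_trans ith _; exact: (emb_seg WO).
have K x : lt x th -> exists y, lt y lam /\ forall h, H h -> ~ h x y.
  move=> xth; apply: NNPP => N; apply: (card_nemb _ _ clam nul).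
  apply: (emb_sub _ (fun y => exists h, H h /\ h x y)).
    move=> y yl; apply: NNPP => M; apply: N; exists y; split=> // h Hh hxy; apply: M; by exists h.
  apply: (emb_union WO) => //; first by apply: emb_trans e _; exact: (emb_seg WO).
  move=> h Hh; case: (Hb h Hh x (Dth x xth)) => _ [hc _].
  apply: emb_trans (le_card_emb lam _ _ hc) _; apply: (emb_seg WO); exact: (le_tr WO) chth thnu.
have [g gP] := choice_on lam _ _ K.
have refl : eq_card (seg th) (seg th) by apply: cantor_bernstein; exact: emb_incl.
have [h [Hh E]] := Hm (seg th) (fun x => Dth x) refl g (fun x h => proj1 (gP x h)).
have [f [fP _]] := eq_card_emb_sym lam _ _ E.
case: ith => n [nth _].
have [xth hx] := fP (n 0) (nth 0 I).
by case: (gP _ xth) => _ /(_ h Hh).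
Qed.

(** By [family_size], the equation [m = lam] reduces to this upper bound. *)
Definition small_family (D : O -> Prop) : Prop :=
  exists H, m_family lt D lam th ch H /\ emb H (seg lam).

Lemma m_is_small (D : O -> Prop) : (forall x, lt x th -> D x) ->
  m_is lt D lam th ch lam <-> small_family D.
Proof.
move=> Dth; split=> [[[H [mH E]] _]|[H [mH e]]].
  by exists H; split=> //; exact: (eq_card_emb lam).
split; last by move=> H' mH'; apply: emb_le_card; exact: family_size mH'.
exists H; split=> //; apply: cantor_bernstein => //; exact: family_size mH.
Qed.

Lemma eq_th_unbounded (X : O -> Prop) : (forall x, X x -> lt x th) -> eq_card X (seg th) ->
  forall b, lt b th -> exists z, X z /\ le b z.
Proof.
move=> Xth E b bth.
have e : emb (seg th) (fun x => X x /\ lt x th).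
  apply: emb_trans (eq_card_emb_sym lam _ _ E) _; apply: emb_incl => x Xx; split=> //; exact: Xth.
have [z [Xz [_ h]]] := emb_unbounded WO cth _ e b bth; by exists z.
Qed.

Lemma unbounded_eq_th (X : O -> Prop) : (forall x, X x -> lt x th) ->
  (forall b, lt b th -> exists z, X z /\ le b z) -> eq_card X (seg th).
Proof.
move=> Xth U; apply: cantor_bernstein; first exact: emb_incl.
apply: (emb_trans _ (fun x => X x /\ lt x th)); last by apply: emb_incl => x [].
apply: (unbounded_emb WO rth) => b /U [z [Xz h]]; exists z; split=> //; split=> //; exact: Xth.
Qed.

Lemma increasing_le s a z z' : increasing_cofinal (lt := lt) (th := th) s a ->
  lt z' th -> le z z' -> le (s z) (s z').
Proof. move=> [_ [si _]] z'th [h|->]; [left; exact: si|exact: le_refl]. Qed.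

Lemma J_small_family (S : O -> Prop) : (forall a, S a -> E_cof lt th a) ->
  stationary lt S -> J_ideal lt ch S -> small_family (seg th).
Proof.
move=> Sth Sst [C [Cclub [F [Fch FP]]]].
(* A point [a] above [lam] makes functions into [lam] regressive on a tail of the ladder [s]. *)
have [a [Sa [Ca la]]] := Sst _ (club_tail C lam Cclub).
have ca : is_cof lt a th := Sth a Sa.
have [s sP] := cof_increasing WO a ca; have [sa [si sc]] := sP.
exists (fun h => exists i, lt i a /\ h = (fun z y => lt y lam /\ F i (s z) y)); split; last first.
  apply: (emb_trans _ (seg a)); last exact: emb_le_lam.
  apply: (emb_image lam _ (fun i z y => lt y lam /\ F i (s z) y)) => h [i [ia ->]].
  by exists i.
split.
  move=> h [i [ia ->]] x xth; split; first by move=> y [].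
  apply: (lt_card_emb lam _ (F i (s x))) => //; apply: emb_incl => y [] //.
move=> X Xth EX g gl.
have Xub := eq_th_unbounded X Xth EX.
have inj z z' : lt z th -> lt z' th -> s z = s z' -> z = z'.
  move=> zth z'th E; case: (lt_tri WO z z') => [h|[//|h]].
    by case: (lt_irr WO (s z)); rewrite {2}E; exact: si.
  by case: (lt_irr WO (s z)); rewrite {1}E; exact: si.
have [bot [_ botP]] : exists x, True /\ forall y, True -> le x y.
  by apply: (least WO); exists lam.
(* [f] copies [g] along the ladder at the points above [lam]; elsewhere the least element [bot]
   keeps it regressive. *)
have K b : lt b a -> exists y, lt y a /\ ((exists z, lt z b) -> lt y b) /\
    forall z, X z -> b = s z -> lt lam b -> y = g z.
  move=> ba; case: (classic (exists z, X z /\ b = s z /\ lt lam b)) => [[z [Xz [bE lb]]]|N].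
    exists (g z); split; first exact: (lt_tr WO) (gl z Xz) la.
    split; first by move=> _; exact: (lt_tr WO) (gl z Xz) lb.
    by move=> z' Xz' E _; congr g; apply: inj; rewrite -?E -?bE //; exact: Xth.
  exists bot; split; first exact: (le_lt WO) (botP b I) ba.
  split; first by move=> [z zb]; exact: (le_lt WO) (botP z I) zb.
  by move=> z Xz E lb; case: N; exists z.
have [f fP] := choice_on lam _ _ K.
pose B b := exists z, X z /\ b = s z /\ lt lam b.
have Ba b : B b -> lt b a by move=> [z [Xz [-> _]]]; apply: sa; exact: Xth.
have Bc : cofinal_in lt B a.
  move=> b ba; have [m [m1 [m2 m3]]] := max2 WO b lam.
  have ma : lt m a by case: m3 => ->.
  have [c [mc ca']] := cof_limit WO ith a ca m ma.
  have [z [zth cz]] := sc c ca'; have [z' [Xz' zz']] := Xub z zth.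
  have h : lt m (s z').
    apply: (lt_le_tr WO) mc _; apply: (le_tr WO) cz _; apply: increasing_le sP _ zz'; exact: Xth.
  exists (s z'); split; last by left; exact: (le_lt WO) m1 h.
  by exists z'; split=> //; split=> //; exact: (le_lt WO) m2 h.
have [i [ia iP]] := FP a Sa Ca f (fun b ba => proj1 (fP b ba))
   (fun b ba => proj1 (proj2 (fP b ba))) B Ba Bc.
exists (fun z y => lt y lam /\ F i (s z) y); split; first by exists i.
apply: unbounded_eq_th; first by move=> x [/Xth].
move=> b bth; have [_ [[[z [Xz [-> lz]]] Fz]] h] := iP (s b) (sa b bth).
exists z; split; last first.
  by apply: (nlt_le WO) => zb; apply: (lt_irr WO (s z)); apply: (lt_tr WO) h; exact: si.
split=> //; split; first exact: gl.
have zth := Xth z Xz.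
by have [_ [_ <-]] := fP (s z) (sa z zth).
Qed.

Lemma emb_th_del {X : Type} (A : X -> Prop) p :
  emb (seg th) (fun x => A x \/ x = p) -> emb (seg th) A.
Proof.
move=> [u [uA uI]]; case: (classic (exists z, lt z th /\ u z = p)) => [[z [zth E]]|N].
  apply: (emb_trans _ (fun x => lt z x /\ lt x th)).
    apply: (unbounded_emb WO rth) => b bth.
    have [m [m1 [m2 m3]]] := max2 WO b z.
    have mth : lt m th by case: m3 => ->.
    have [c [mc cth']] := card_limit WO th cth ith m mth.
    exists c; split; first exact: (le_lt WO) m2 mc.
    by split=> //; left; exact: (le_lt WO) m1 mc.
  exists u; split=> [x [zx xth]|x x' [_ h] [_ h']]; last exact: uI.
  case: (uA x xth) => // E'; case: (lt_irr WO z); rewrite {2}(uI z x) // E E'; done.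
exists u; split=> // x xth; case: (uA x xth) => // E; case: N; by exists x.
Qed.

Lemma small_family_lift : small_family (seg th) -> small_family (seg lam).
Proof.
move=> [H [[Hb Hm] He]].
have [d dP] := choice_on (fun x => x) _ _ (fun nu (h : is_cof lt nu th) => cof_increasing WO nu h).
(* [t nu x] is the level of [x] on the ladder [d nu]: some [z] with [x <= d nu z], arbitrary when
   there is none. *)
have K (p : O * O) : True -> exists z, lt z th /\
    forall z', lt z' th -> le (snd p) (d (fst p) z') -> le (snd p) (d (fst p) z).
  move=> _; case: (classic (exists z, lt z th /\ le (snd p) (d (fst p) z))) => [[z [zth h]]|N].
    by exists z.
  case: ith => n [nth _]; exists (n 0); split; first exact: nth.
  by move=> z' z'th h; case: N; exists z'.
have [t0 t0P] := choice_on lam _ _ K.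
pose t nu x := t0 (nu, x).
have tth nu x : lt (t nu x) th by case: (t0P (nu, x) I).
have tP nu x z : lt z th -> le x (d nu z) -> le x (d nu (t nu x)).
  by case: (t0P (nu, x) I) => _ h; exact: h.
exists (fun h' => exists nu h, lt nu lam /\ H h /\ h' = (fun x y => h (t nu x) y)); split; last first.
  apply: (emb_trans _ (prodP (seg lam) H)).
    apply: (emb_image (lam, fun _ _ => False) _ (fun p x y => snd p (t (fst p) x) y)).
    by move=> h' [nu [h [nul [Hh ->]]]]; exists (nu, h).
  apply: emb_trans (emb_prod _ _ _ _ (emb_incl _ _ (fun x h => h)) He) _; exact: (sq_emb WO).
split.
  by move=> h' [nu [h [nul [Hh ->]]]] x _; exact: (Hb h Hh (t nu x) (tth nu x)).
move=> X Xl EX g gl.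
have eX : emb (seg th) (fun x => X x /\ lt x lam).
  apply: emb_trans (eq_card_emb_sym lam _ _ EX) _; apply: emb_incl => x Xx; split=> //; exact: Xl.
have [nu [nuX nul]] := least WO (fun nu => emb (seg th) (fun x => X x /\ lt x nu)) (ex_intro _ lam eX).
have small b : lt b nu -> ~ emb (seg th) (fun x => X x /\ lt x b).
  by move=> bnu /nul /(le_nlt WO).
(* By pigeonhole and minimality of [nu], fewer than [th] segments below [nu] never cover [X] there.
   This yields both cofinality [th] and levels unbounded in [th]. *)
have cover d' v : lt d' th -> (forall b, lt b d' -> lt (v b) nu) ->
    ~ (forall x, X x -> lt x nu -> exists j, lt j d' /\ le x (v j)).
  move=> d'th vnu cov.
  have e : emb (seg th) (fun x => exists j, lt j d' /\ (X x /\ le x (v j))).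
    apply: emb_trans nuX _; apply: emb_incl => x [Xx xnu].
    by have [j [jd h]] := cov x Xx xnu; exists j.
  have [j [jd e']] := emb_pigeon WO rth _ _ d'th e.
  apply: (small (v j) (vnu j jd)); apply: (emb_th_del _ (v j)).
  apply: emb_trans e' _; apply: emb_incl => x [Xx [h|->]]; by [left|right].
have cnu : is_cof lt nu th.
  have [u [uX uI]] := nuX.
  apply: (is_cofI WO nu th u) => [b bth|c cnu|d' v d'th vnu].
  by case: (uX b bth).
  apply: NNPP => N; apply: (small c cnu); exists u; split=> // b bth.
  split; first by case: (uX b bth).
  case: (le_or_lt WO c (u b)) => // h; case: N; by exists b.
  apply: NNPP => N; apply: (cover d' v d'th vnu) => x Xx xnu.
  apply: NNPP => M; apply: N; exists x; split=> // b bd.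
  case: (le_or_lt WO x (v b)) => // h; case: M; by exists b.
have nulam : lt nu lam.
  by case: (nul lam eX) => // E; case: ncof; rewrite -E.
have [da [di dc]] := dP nu cnu.
pose U z := exists x, X x /\ lt x nu /\ t nu x = z.
have EU : eq_card U (seg th).
  apply: unbounded_eq_th; first by move=> z [x [_ [_ <-]]].
  move=> b bth; apply: NNPP => N; apply: (cover b (d nu) bth).
    by move=> z zb; apply: da; exact: (lt_tr WO) zb bth.
  move=> x Xx xnu; exists (t nu x); split; last first.
    have [z [zth h]] := dc x xnu; exact: tP zth h.
  case: (le_or_lt WO b (t nu x)) => // h; case: N; exists (t nu x); split=> //; by exists x.
(* One point [w z] of [X] is kept on each level [z], so that [g] becomes a function of the level. *)
have [w wP] := choice_on lam U _ (fun z h => h).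
have [h [Hh Eh]] := Hm U (fun z '(ex_intro _ x (conj _ (conj _ E))) => eq_ind _ (fun z => lt z th) (tth nu x) _ E)
   EU (fun z => g (w z)) (fun z Uz => gl _ (proj1 (wP z Uz))).
exists (fun x y => h (t nu x) y); split; first by exists nu, h.
apply: cantor_bernstein.
  apply: emb_trans (eq_card_emb lam _ _ EX); apply: emb_incl => x [] //.
apply: emb_trans (eq_card_emb_sym lam _ _ Eh) _; exists w; split.
  by move=> z [Uz hz]; case: (wP z Uz) => Xw [_ E]; split=> //; rewrite E.
by move=> z z' [Uz _] [Uz' _] E; case: (wP z Uz) => _ [_ <-]; case: (wP z' Uz') => _ [_ <-]; rewrite E.
Qed.

End Main.
End Families.

(** * From covering families to the ideal J *)

Section Approachable.
Context {O : Type} {lt : O -> O -> Prop} (WO : well_order lt).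
Local Notation le := (Defs.le lt).
Local Notation seg := (Defs.seg lt).

Section Main.
Context {lam th ch : O} (clam : is_cardinal lt lam) (ilam : inf (seg lam)).
Context (slam : succ_of (lt := lt) (fun _ => True) lam).
Context (cth : is_cardinal lt th) (ith : inf (seg th)) (rth : is_cof lt th th).
Context (chth : le ch th) (thlam : lt th lam) (ncof : ~ is_cof lt lam th).

Section Hull.
Context (e : O -> O -> O) (av : O -> O -> Prop).
Context (elam : forall d x, lt x d -> lt (e d x) lam).
Context (einj : forall d x y, lt x d -> lt y d -> e d x = e d y -> x = y).

Definition hull_step (i b d : O) : Prop :=
  lt b d /\ (lt (e d b) i \/
    exists j, lt j d /\ lt (e d j) i /\ emb (av j) (seg th) /\ av j b).

Definition hull (i : O) : O -> O -> Prop := clos_trans O (hull_step i).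

Lemma hull_lt i b d : hull i b d -> lt b d.
Proof. elim=> [x y []|x y z _ h _ h'] //; exact: (lt_tr WO) h h'. Qed.

(** The bound [nu] is the larger of [i] and [th], the same for all [d]; so the induction on [d] only
    forms unions of at most [nu] sets of size at most [nu]. *)
Lemma hull_small i d : lt i lam -> exists nu, lt nu lam /\ emb (fun x => hull i x d) (seg nu).
Proof.
move=> il; have [nu [inu [thnu nuE]]] := max2 WO i th.
exists nu; split; first by case: nuE => ->.
have nuinf : inf (seg nu) by apply: emb_trans ith _; exact: (emb_seg WO).
have ei d' : emb (fun x => lt x d' /\ lt (e d' x) i) (seg nu).
  exists (e d'); split=> [x [_ h]|x y [xd _] [yd _]]; first exact: (lt_le_tr WO) h inu.
  exact: einj.
have step d' : emb (fun x => hull_step i x d') (seg nu).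
  have U : emb (fun x => exists b : bool, True /\
      (if b then lt x d' /\ lt (e d' x) i else
       exists j, (lt j d' /\ lt (e d' j) i /\ emb (av j) (seg th)) /\ av j x)) (seg nu).
    apply: (emb_union WO) => //.
      by apply: (emb_trans _ (fun _ : nat => True)) nuinf; exists (fun b : bool => if b then 0 else 1);
        split=> // -[] [].
    case=> _; first exact: ei.
    apply: (emb_union WO) => //.
      by apply: (emb_sub _ _ _ _ (ei d')) => x [h [h' _]].
    move=> j [_ [_ h]]; apply: emb_trans h _; exact: (emb_seg WO).
  apply: emb_trans U; apply: emb_incl => x [xd [h|[j [jd [ej [s h]]]]]]; [by exists true|].
  by exists false; split=> //; exists j.
elim/(well_founded_ind (lt_wf WO)): d => d IH.
have U : emb (fun x => exists b, hull_step i b d /\ (hull i x b \/ x = b)) (seg nu).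
  apply: (emb_union WO) => // b [bd _]; apply: emb_add => //; exact: IH.
apply: emb_trans U; apply: emb_incl => x h.
have [b [hx hb]] : exists b, hull_step i b d /\ (hull i x b \/ x = b).
  elim: h => [y z h|y z w hyz _ _ [b [h1 h2]]]; first by exists y; split=> //; right.
  exists b; split=> //; left; case: h2 => [h2|<- //]; exact: t_trans hyz h2.
by exists b.
Qed.

(** Greedy colouring along the order: at [d] fewer than [lam] colours are forbidden. *)
Lemma hull_color i : lt i lam -> exists t, forall d, lt (t d) lam /\
  forall x, hull i x d -> t x <> t d.
Proof.
move=> il.
apply: (rec_choice lt lam (fun d t y => lt y lam /\ forall x, hull i x d -> t x <> y)); first exact: (lt_wf WO).
  move=> d t t' y E [h h']; split=> // x hx; rewrite -(E x (hull_lt _ _ _ hx)); exact: h'.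
move=> d t _; apply: NNPP => N.
have [nu [nul em]] := hull_small i d il.
apply: (card_nemb _ _ clam nul); apply: emb_trans em.
apply: (emb_image lam _ t) => y yl; apply: NNPP => M; apply: N; exists y; split=> // x hx E.
by apply: M; exists x.
Qed.

(* The chain alternates between [B] and [A]: each [b z] in [B] is trapped below some [y z] in
   [A], and the next [b z'] already sees an initial segment of [A] containing [y z]. *)
Lemma hull_chain a A (B : O -> Prop) : is_cof lt a th -> order_type lt A th ->
  (forall x, A x -> lt x a) -> cofinal_in lt A a ->
  (forall g, lt g a -> exists b, lt b a /\ forall x, (A x /\ lt x g) <-> av b x) ->
  (forall b, B b -> lt b a) -> cofinal_in lt B a ->
  exists i b (Z : O -> Prop), lt i lam /\
    (forall z, lt z th -> exists z', Z z' /\ le z z') /\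
    (forall z, Z z -> lt z th /\ B (b z) /\ exists y, lt y (b z)) /\
    (forall z z', Z z -> Z z' -> lt z z' -> hull i (b z) (b z')) /\
    (forall g, lt g a -> exists z0, lt z0 th /\ forall z, Z z -> le z0 z -> lt g (b z)).
Proof.
move=> ca [s [si [sA sS]]] Aa Ac Ainit Ba Bc.
have [f [fa fc]] := cof_fun a th ca.
have alim := cof_limit WO ith a ca.
have above (Q : O -> Prop) m : cofinal_in lt Q a -> lt m a -> exists q, Q q /\ lt m q.
  move=> Qc ma; have [c [mc ca']] := alim m ma; have [q [Qq cq]] := Qc c ca'.
  exists q; split=> //; exact: (lt_le_tr WO) mc cq.
(* One round picks [x] in [A] beyond all earlier [y], an index [j] of the part of [A] below [x],
   then [b] in [B] above both, then the next value [yz] in [A] above [b]. *)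
pose R z (y : O -> O) yz p := let '(x, j, b) := p in
  A x /\ (forall z', lt z' z -> lt (y z') x) /\ lt (f z) x /\
  lt j b /\ (forall w, (A w /\ lt w x) <-> av j w) /\ lt x b /\ B b /\ lt b yz /\ A yz.
have [y yP] : exists y, forall z, lt z th -> exists p, R z y (y z) p.
  apply: (rec_choice lt lam (fun z y yz => lt z th -> exists p, R z y yz p)); first exact: (lt_wf WO).
    move=> z y y' yz E h /h [[[x j] b] [h1 [h2 h3]]]; exists (x, j, b); split=> //; split=> //.
    move=> z' l; rewrite -E //; exact: h2.
  move=> z y IH; case: (classic (lt z th)) => zth; last by exists z.
  have K z' : lt z' z -> lt (y z') a.
    move=> l; have [[[x j] b] hp] := IH z' l (lt_tr WO _ _ _ l zth).
    by apply: Aa; case: hp => _ [_ [_ [_ [_ [_ [_ []]]]]]].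
  have [c [c1 cb]] := cof_bound WO a th z y ca zth K.
  have [m [m1 [m2 m3]]] := max2 WO c (f z).
  have ma : lt m a by case: m3 => ->; auto.
  have [x [Ax mx]] := above A m Ac ma.
  have [j [ja jP]] := Ainit x (Aa x Ax).
  have [m' [m1' [m2' m3']]] := max2 WO x j.
  have ma' : lt m' a by case: m3' => ->; auto.
  have [b [Bb mb]] := above B m' Bc ma'.
  have [yz [Ay by_]] := above A b Ac (Ba b Bb).
  exists yz => _; exists (x, j, b); split=> //.
  split; first by move=> z' l; apply: (lt_tr WO) mx; apply: (lt_le_tr WO) m1; exact: cb.
  split; first exact: (le_lt WO) m2 mx.
  split; first exact: (le_lt WO) m2' mb.
  split=> //; split; first exact: (le_lt WO) m1' mb.
  by [].
have [p pP] := choice_on (lam, lam, lam) _ _ yP.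
pose b z := snd (p z); pose j z := snd (fst (p z)); pose x z := fst (fst (p z)).
have P z : lt z th -> R z y (y z) (x z, j z, b z).
  move=> zth; have := pP z zth; rewrite /x /j /b; by case: (p z) => [[? ?] ?].
(* [u z] bounds the two ranks that the round uses; [bounded_on_unbounded] then makes a single [i]
   work for unboundedly many rounds. *)
have K z : lt z th -> exists m, lt m lam /\ lt (e (b z) (j z)) m /\ lt (e (y z) (b z)) m.
  move=> /P [_ [_ [_ [jb [_ [_ [_ [by_ _]]]]]]]].
  have [m [m1 [m2 m3]]] := max2 WO (e (b z) (j z)) (e (y z) (b z)).
  have ml : lt m lam by case: m3 => ->; exact: elam.
  have [c [mc cl]] := card_limit WO lam clam ilam m ml.
  by exists c; split=> //; split; apply: (le_lt WO) mc.
have [u uP] := choice_on lam _ _ K.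
have [i [il iP]] := bounded_on_unbounded WO rth lam u ncof (fun z zth => proj1 (uP z zth)).
pose Z z := lt z th /\ le (u z) i.
have by_ z : Z z -> hull_step i (b z) (y z).
  move=> [zth ui]; case: (P z zth) => _ [_ [_ [_ [_ [_ [_ [h _]]]]]]].
  split=> //; left; apply: (lt_le_tr WO) ui; by case: (uP z zth) => _ [].
have yb z z' : Z z -> Z z' -> lt z z' -> hull_step i (y z) (b z').
  move=> [zth _] [z'th ui] zz'.
  case: (P z zth) => _ [_ [_ [_ [_ [_ [_ [_ Ay]]]]]]].
  case: (P z' z'th) => Ax' [yx [_ [jb [jP [xb _]]]]].
  split; first by apply: (lt_tr WO) xb; exact: yx.
  (* [y z] lies in [A] below [x z'], that is in [av (j z')], whose size is at most [th] because [A]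
     has order type [th]. *)
  right; exists (j z'); split=> //.
  split; first by apply: (lt_le_tr WO) ui; case: (uP z' z'th) => _ [].
  split; last by apply/jP; split=> //; exact: yx.
  apply: (emb_image lam _ s) => w /jP [/sS [v [vth E]] _]; by exists v.
exists i, b, Z; split=> //.
split; first by move=> z /iP [z' [h1 [h2 h3]]]; exists z'.
split.
  move=> z [zth _]; split=> //; case: (P z zth) => _ [_ [_ [jb [_ [_ [Bb _]]]]]].
  by split=> //; exists (j z).
split.
  move=> z z' Zz Zz' l; apply: (t_trans _ _ _ (y z)); apply: t_step; [exact: by_|exact: yb].
move=> g ga; have [z0 [z0th gz]] := fc g ga; exists z0; split=> // z [zth _] z0z.
have fb z' : lt z' th -> lt (f z') (b z') /\ lt (x z') (b z').
  move=> /P [_ [_ [fx [_ [_ [xb _]]]]]]; split=> //; exact: (lt_tr WO) fx xb.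
apply: (le_lt WO) gz _; case: z0z => [l|<-]; last by case: (fb z0 z0th).
case: (P z0 z0th) => _ [_ [fx [_ [_ [xb [_ [h _]]]]]]].
case: (P z zth) => _ [yx [_ [_ [_ [xb' _]]]]].
apply: (lt_tr WO) xb'; apply: (lt_tr WO) (yx z0 l); apply: (lt_tr WO) h.
exact: (lt_tr WO) fx xb.
Qed.

End Hull.

Lemma approachable_J (S : O -> Prop) : small_family (lt := lt) (lam := lam) (th := th) (ch := ch) (seg lam) ->
  I_ideal lt S -> (forall a, S a -> E_cof lt th a) -> J_ideal lt ch S.
Proof.
move=> [H [[Hb Hm] He]] [av [_ [C [Cclub CP]]]] Sth.
have [e0 e0P] := choice_on (fun _ => lam) (fun _ => True) _
  (fun d _ => emb_le_lam slam d).
have elam d x : lt x d -> lt (e0 d x) lam by case: (e0P d I) => h _; exact: h.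
have einj d x y : lt x d -> lt y d -> e0 d x = e0 d y -> x = y.
  by case: (e0P d I) => _ h; exact: h.
have [t tP] := choice_on (fun _ => lam) _ _ (hull_color e0 av einj).
have thl x : lt x th -> lt x lam by move=> h; exact: (lt_tr WO) h thlam.
have [h0 Hh0] : exists h, H h.
  have [h [Hh _]] := Hm (seg th) thl (cantor_bernstein _ _ (emb_incl _ _ (fun _ h => h))
     (emb_incl _ _ (fun _ h => h))) (fun _ => th) (fun _ _ => thlam).
  by exists h.
have [i0 i0l] : exists i, lt i lam by exists th.
have eI : emb (prodP (seg lam) H) (seg lam).
  apply: emb_trans (emb_prod _ _ _ _ (emb_incl _ _ (fun x h => h)) He) _; exact: (sq_emb WO).
(* [G] lists all pairs of a hull index and a member of [H] in [lam] steps, so the index [q] found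
   later lies below [a], which exceeds [lam]. *)
have [G [GI GS]] := emb_enum _ _ (i0, h0) (conj i0l Hh0) eI.
exists (fun x => C x /\ lt lam x); split; first exact: club_tail.
(* With the colour of [b] as argument and values pulled back along the injection [e0 b] of [b] into
   [lam], a covering function becomes a small set of ordinals below [b]. *)
exists (fun q b y => lt y b /\ snd (G q) (t (fst (G q)) b) (e0 b y)); split.
  move=> q b; have [il Hh] := GI q.
  have [tl _] := tP _ il b.
  have [_ hc] := Hb _ Hh _ tl.
  apply: (lt_card_emb lam _ _ _ lam lam) hc; exists (e0 b); split=> [y []|y y' [h _] [h' _]] //.
  exact: einj.
move=> a Sa [Ca la] f fa freg B Ba Bc.
have ca : is_cof lt a th := Sth a Sa.
have [A [Aa [Ac [[c [cc oA]] Ainit]]]] := CP a Sa Ca.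
have Ec := is_cof_unique WO a _ _ cc ca; subst c.
have [i [b [Z [il [Zub [ZP [Zh Zc]]]]]]] := hull_chain e0 av elam a A B ca oA Aa Ac Ainit Ba Bc.
have tl z : lt (t i (b z)) lam by case: (tP i il (b z)).
have tinj z z' : Z z -> Z z' -> t i (b z) = t i (b z') -> z = z'.
  move=> Zz Zz' E; case: (lt_tri WO z z') => [l|[//|l]].
    by case: (tP i il (b z')) => _ /(_ _ (Zh z z' Zz Zz' l)) /(_ E).
  by case: (tP i il (b z)) => _ /(_ _ (Zh z' z Zz' Zz l)); rewrite E.
pose X x := exists z, Z z /\ t i (b z) = x.
have EZ : eq_card Z (seg th).
  apply: (unbounded_eq_th WO rth) => // z; by case/ZP.
have EX : eq_card X (seg th).
  apply: cantor_bernstein.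
    apply: emb_trans (eq_card_emb lam _ _ EZ); by apply: (emb_image lam _ (fun z => t i (b z))).
  apply: emb_trans (eq_card_emb_sym lam _ _ EZ) _; exists (fun z => t i (b z)); split; last exact: tinj.
  by move=> z Zz; exists z.
have [w wP] := choice_on lam X _ (fun x h => h).
have fl z : Z z -> lt (f (b z)) (b z).
  by move=> /ZP [_ [Bb ne]]; apply: freg => //; exact: Ba.
(* The function to be covered lives on the colours: a colour leads back by [w] to a stage, and the
   value is the [e0]-rank of [f] at the point [b] of that stage. *)
have [h [Hh Eh]] := Hm X (fun x '(ex_intro _ z (conj _ E)) => eq_ind _ (fun x => lt x lam) (tl z) _ E) EX
  (fun x => e0 (b (w x)) (f (b (w x)))) (fun x Xx => elam _ _ (fl _ (proj1 (wP x Xx)))).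
have [q [ql qE]] := GS (i, h) (conj il Hh).
exists q; split; first exact: (lt_tr WO) ql la.
move=> g ga; have [z0 [z0th z0P]] := Zc g ga.
pose Z' z := Z z /\ h (t i (b z)) (e0 (b z) (f (b z))).
have e' : emb (seg th) (fun z => Z' z /\ lt z th).
  apply: emb_trans (eq_card_emb_sym lam _ _ Eh) _; exists w; split.
    move=> x [Xx hx]; case: (wP x Xx) => Zw E; split; last by case: (ZP _ Zw).
    by split=> //; rewrite E.
  by move=> x x' [Xx _] [Xx' _] E; case: (wP x Xx) => _ <-; case: (wP x' Xx') => _ <-; rewrite E.
have [z [[Zz hz] [zth z0z]]] := emb_unbounded WO cth _ e' z0 z0th.
exists (b z); split; last exact: z0P.
split; first by case: (ZP z Zz) => _ [].
by rewrite qE; split=> //; exact: fl.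
Qed.

End Main.
End Approachable.

(** * Approachable points: lambda = theta^+ *)

Section Traces.
Context {O : Type} {lt : O -> O -> Prop} (WO : well_order lt).
Local Notation le := (Defs.le lt).
Local Notation seg := (Defs.seg lt).
Local Notation succ_of := (succ_of (lt := lt)).
Local Notation club_in := (club_in (lt := lt)).

Lemma succ_exists nu top : inf (seg nu) -> ~ emb (seg top) (seg nu) ->
  exists sg, is_cardinal lt sg /\ succ_of (seg sg) nu /\ le sg top.
Proof.
move=> inu ntop.
have [sg [nsg sgl]] := least WO (fun a => ~ emb (seg a) (seg nu)) (ex_intro _ top ntop).
have below b : lt b sg -> emb (seg b) (seg nu).
  by move=> bsg; apply: NNPP => /sgl /(le_nlt WO).
exists sg; split.
  move=> b bsg h; apply: nsg; apply: emb_trans (le_card_emb nu _ _ h) _; exact: below.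
split; last exact: sgl.
by split; [exact: (seg_closed WO)|].
Qed.

Section Approachable.
Context {lam th : O} (clam : is_cardinal lt lam) (ilam : inf (seg lam)).
Context (slam : succ_of (fun _ => True) lam).
Context (cth : is_cardinal lt th) (ith : inf (seg th)) (rth : is_cof lt th th).
Context (thlam : lt th lam).

(* The list of bounded sets in the definition of [I] is indexed here by pairs [(s, k)] with
   [k < lam]; by [emb_pairs] and closing off this is the same on a club. *)
Definition listed (Q : O -> O -> O -> Prop) (a : O) : Prop :=
  is_cof lt a th /\ exists A : O -> Prop, (forall x, A x -> lt x a) /\ cofinal_in lt A a /\
    (forall g, lt g a -> ~ emb (seg th) (fun x => A x /\ lt x g)) /\
    forall g, lt g a -> exists s k, lt s a /\ lt k lam /\ forall x, (A x /\ lt x g) <-> Q s k x.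

(** In the lexicographic order a pair has at most [lam] predecessors, so the greedy map into an
    order of size beyond [lam] never stalls. *)
Lemma emb_pairs : emb (prodP (fun _ : O => True) (seg lam)) (fun _ : O => True).
Proof.
apply: (greedy (slexprod O O lt lt) _ _ lam).
    by apply: wf_slexprod; exact: (lt_wf WO).
  apply: slex_tri; exact: (lt_tri WO).
move=> [s k] _ E; case: slam => _ [_ [le_lam nle]]; apply: nle.
apply: emb_trans E _; apply: (emb_trans _ (prodP (fun x => le x s) (seg lam))).
  apply: emb_incl => -[s' k'] [h [_ k'l]]; split=> //=.
  by inversion h; [left|right].
apply: emb_trans (sq_emb WO _ ilam); apply: emb_prod; last exact: emb_incl.
by apply: emb_le_seg => //; exact: le_lam.
Qed.

Lemma listed_I Q : I_ideal lt (listed Q).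
Proof.
have [code [_ codeI]] := emb_pairs.
have K b : True -> exists p : O * O, forall s k, lt k lam -> code (s, k) = b -> p = (s, k).
  move=> _; case: (classic (exists s k, lt k lam /\ code (s, k) = b)) => [[s [k [kl E]]]|N].
    exists (s, k) => s' k' k'l E'; apply: codeI => //; by rewrite E.
  by exists (lam, lam) => s k kl E; case: N; exists s, k.
have [dec decP] := choice_on (lam, lam) _ _ K.
pose P b x := Q (fst (dec b)) (snd (dec b)) x.
(* A set that is not bounded is replaced by the empty one, as the members of the sequence must be
   bounded. *)
exists (fun b x => P b x /\ exists g, forall y, P b y -> lt y g); split.
  move=> b; case: (classic (exists g, forall y, P b y -> lt y g)) => [[g h]|N].
    by exists g => x [Px _]; exact: h.
  by exists lam => x [_ h]; case: N.
have K' s : True -> exists y, forall k, lt k lam -> lt (code (s, k)) y.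
  move=> _; have [y [_ h]] := succ_bound WO slam (seg lam) (fun k => code (s, k)) (emb_incl _ _ (fun _ h => h)) (fun _ _ => I).
  by exists y.
have [g gP] := choice_on lam _ _ K'.
(* At points closed under [g], the code of [(s, k)] lies below [a] as soon as [s] does. *)
exists (fun a => forall x, lt x a -> lt (g x) a); split.
  by apply/club_club_in; exact: (club_closure WO slam).
move=> a [ca [A [Aa [Ac [sm init]]]]] clo.
exists A; split=> //; split=> //; split.
  exists th; split=> //; exact: (order_typeI WO a).
move=> x0 x0a; have [s [k [sa [kl H]]]] := init x0 x0a.
exists (code (s, k)); split; first by apply: (lt_tr WO) (clo s sa); exact: gP.
have E : dec (code (s, k)) = (s, k) by exact: (decP _ I).
move=> x; rewrite /P E /=; split=> [/H h|[h _]]; last by apply/H.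
by split=> //; exists x0 => y /H [].
Qed.

Lemma index_enum : exists G : O -> O * O, forall i j, lt i lam -> lt j lam ->
  exists k, lt k lam /\ G k = (i, j).
Proof.
have [G [_ GS]] := emb_enum _ _ (th, th) (conj thlam thlam) (sq_emb WO lam ilam).
by exists G => i j il jl; exact: (GS (i, j)).
Qed.

Section SuccessorOfTheta.
Context (slth : succ_of (seg lam) th).
Context (e : O -> O -> O) (elam : forall d x, lt x d -> lt (e d x) lam).
Context (einj : forall d x y, lt x d -> lt y d -> e d x = e d y -> x = y).

Definition trace (i d x : O) : Prop := lt x d /\ lt (e d x) i.

(** For [m < lam] at most [th] pairs have both their ranks at most [m], so the remaining rank is
    bounded in [lam], here theta^+. At a closure point [i] of these bounds, having rank below [i]
    means the same for [e a] and [e c]. *)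
Lemma coherent_trace a : is_cof lt a th -> exists i, lt i lam /\
  cofinal_in lt (trace i a) a /\
  forall c x, trace i a c -> lt x c -> (trace i a x <-> trace i c x).
Proof.
move=> ca.
have le_th m : lt m lam -> emb (seg m) (seg th) by case: slth => _ [_ [h _]]; exact: h.
pose Q m m' := forall c x, lt c a -> lt x c -> le (e a c) m ->
  (le (e a x) m -> lt (e c x) m') /\ (le (e c x) m -> lt (e a x) m').
have sq m : lt m lam -> emb (prodP (fun y => le y m) (fun y => le y m)) (seg th).
  move=> ml; apply: emb_trans (sq_emb WO _ ith).
  by apply: emb_prod; apply: emb_le_seg => //; exact: le_th.
have step m : lt m lam -> exists m', lt m' lam /\ lt m m' /\ Q m m'.
  move=> ml.
  pose A1 (p : O * O) := lt (fst p) a /\ lt (snd p) (fst p) /\ le (e a (fst p)) m /\ le (e a (snd p)) m.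
  have eA1 : emb A1 (seg th).
    apply: emb_trans (sq m ml); exists (fun p => (e a (fst p), e a (snd p))).
    split; first by move=> [c x] [/= _ [_ [h h']]].
    move=> [c x] [c' x'] [/= h1 [h2 _]] [/= h1' [h2' _]] [E E'].
    rewrite (einj _ _ _ h1 h1' E) (einj a x x') //; [exact: (lt_tr WO) h1|exact: (lt_tr WO) h1'].
  have [m1 [m1l H1]] := succ_bound WO slth A1 (fun p => e (fst p) (snd p)) eA1
    (fun p h => elam _ _ (proj1 (proj2 h))).
  pose A2 (p : O * O) := lt (fst p) a /\ lt (snd p) (fst p) /\ le (e a (fst p)) m /\ le (e (fst p) (snd p)) m.
  have eA2 : emb A2 (seg th).
    apply: emb_trans (sq m ml); exists (fun p => (e a (fst p), e (fst p) (snd p))).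
    split; first by move=> [c x] [/= _ [_ [h h']]].
    move=> [c x] [c' x'] [/= h1 [h2 _]] [/= h1' [h2' _]] [E E'].
    have Ec := einj _ _ _ h1 h1' E; subst c'; by rewrite (einj c x x').
  have [m2 [m2l H2]] := succ_bound WO slth A2 (fun p => e a (snd p)) eA2
    (fun p h => elam _ _ (lt_tr WO _ _ _ (proj1 (proj2 h)) (proj1 h))).
  have [m3 [m3l H3]] := succ_gt WO slth m ml.
  have [n [n1 [n2 nE]]] := max2 WO m1 m2; have [n' [n1' [n2' nE']]] := max2 WO n m3.
  exists n'; split; first by case: nE' => -> //; case: nE => ->.
  split; first exact: (lt_le_tr WO) H3 n2'.
  move=> c x ca' xc ec; split=> ex.
    apply: (lt_le_tr WO) n1'; apply: (lt_le_tr WO) n1; exact: (H1 (c, x)).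
  apply: (lt_le_tr WO) n1'; apply: (lt_le_tr WO) n2; exact: (H2 (c, x)).
(* The iteration starts above the ranks of a cofinal sequence, so the trace at [i] contains that
   sequence. *)
have [f [fa fc]] := cof_fun a th ca.
have [b [bl fb]] := succ_bound WO slth (seg th) (fun z => e a (f z)) (emb_incl _ _ (fun _ h => h))
  (fun z h => elam _ _ (fa z h)).
have [i [il [bi iP]]] := iterate_sup WO slth Q step b bl.
exists i; split=> //; split.
  move=> x /fc [z [zth h]]; exists (f z); split=> //; split; first exact: fa.
  exact: (lt_tr WO) (fb z zth) bi.
move=> c x [ca' ec] xc.
have main w : lt w i -> exists m, lt m i /\
    (le (e a x) w -> lt (e c x) m) /\ (le (e c x) w -> lt (e a x) m).
  move=> wi; have [n [n1 [n2 nE]]] := max2 WO w (e a c).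
  have ni : lt n i by case: nE => ->.
  have [m [m' [_ [nm [_ [q m'i]]]]]] := iP n ni.
  have [q1 q2] := q c x ca' xc (le_tr WO _ _ _ n2 nm).
  exists m'; split=> //.
  by split=> h; [apply: q1|apply: q2]; apply: (le_tr WO) h _; exact: (le_tr WO) n1 nm.
split=> -[h1 h2]; have [m [mi [q1 q2]]] := main _ h2.
  by split=> //; apply: (lt_tr WO) mi; apply: q1; right.
split; first exact: (lt_tr WO) xc ca'.
by apply: (lt_tr WO) mi; apply: q2; right.
Qed.

(** A coherent cofinal trace may be longer than [th], so it is thinned. A rank [o i] increasing
    along it has a supremum [eta] of cofinality [th], and [Phi] keeps the first point reaching each
    value of the ladder [d eta]. Thinning consults only the trace below a point, so initial segments
    are listed by a point and the pair [(i, eta)]. *)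
Lemma stationary_listed_succ : exists Q, forall a, is_cof lt a th -> listed Q a.
Proof.
have le_th m : lt m lam -> emb (seg m) (seg th) by case: slth => _ [_ [h _]]; exact: h.
have trace_th i x : lt i lam -> emb (fun y => trace i x y) (seg th).
  move=> il; apply: emb_trans (le_th i il); exists (e x); split=> [y []|y y' [h _] [h' _]] //.
  exact: einj.
have Ko i : lt i lam -> exists o : O -> O, forall x, lt (o x) lam /\ forall y, trace i x y -> lt (o y) (o x).
  move=> il; apply: (rec_choice lt lam (fun x o z => lt z lam /\ forall y, trace i x y -> lt (o y) z)).
    exact: (lt_wf WO).
    move=> x o o' z E [zl H]; split=> // y ty; rewrite -(E y (proj1 ty)); exact: H.
  move=> x o IH; have [z [zl H]] := succ_bound WO slth (trace i x) o (trace_th i x il)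
      (fun y ty => proj1 (IH y (proj1 ty))).
  by exists z.
have [o oP] := choice_on (fun x => x) _ _ Ko.
have [d dP] := choice_on (fun x => x) _ _ (fun eta (h : is_cof lt eta th) => cof_increasing WO eta h).
have [G GP] := index_enum.
pose Phi i eta x := exists z, lt z th /\ le (d eta z) (o i x) /\
    forall y, trace i x y -> lt (o i y) (d eta z).
exists (fun s k x => trace (fst (G k)) s x /\ Phi (fst (G k)) (snd (G k)) x) => a ca.
have [i [il [Bc coh]]] := coherent_trace a ca.
pose B x := trace i a x.
have Ba x : B x -> lt x a by case.
have oB y x : B y -> B x -> lt y x -> lt (o i y) (o i x).
  by move=> By Bx yx; apply: (proj2 (oP i il x)); apply/(coh x y Bx yx).
have oB' y x : B y -> B x -> le y x -> le (o i y) (o i x).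
  move=> By Bx [h|->]; [left; exact: oB|exact: le_refl].
have [eta [etaB etal]] : exists eta, (forall x, B x -> lt (o i x) eta) /\
      forall c, (forall x, B x -> lt (o i x) c) -> le eta c.
  apply: (least WO).
  have [c [_ h]] := succ_bound WO slth B (o i) (trace_th i a il) (fun x _ => proj1 (oP i il x)).
  by exists c.
have etalam : lt eta lam.
  have [c [cl h]] := succ_bound WO slth B (o i) (trace_th i a il) (fun x _ => proj1 (oP i il x)).
  exact: (le_lt WO) (etal c h) cl.
have etac c : lt c eta -> exists x, B x /\ le c (o i x).
  move=> ceta; apply: NNPP => N; apply: (le_nlt WO c eta) ceta; apply: etal => x Bx.
  case: (le_or_lt WO c (o i x)) => // h; case: N; by exists x.
have ceta : is_cof lt eta th.
  have [s [sa sc]] := cof_fun a th ca.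
  have K z : lt z th -> exists w, B w /\ le (s z) w by move=> /sa /Bc.
  have [w wP] := choice_on lam _ _ K.
  apply: (is_cofI WO eta th (fun z => o i (w z))).
    by move=> z /wP [Bw _]; exact: etaB.
    move=> c /etac [x [Bx cx]]; have [z [zth h]] := sc x (Ba x Bx).
    exists z; split=> //; apply: (le_tr WO) cx _; have [Bw h'] := wP z zth.
    apply: oB' => //; exact: (le_tr WO) h h'.
  move=> d' v d'th vl.
    have K' j : lt j d' -> exists x, B x /\ le (v j) (o i x) by move=> /vl /etac.
    have [x xP] := choice_on lam _ _ K'.
    have [c [ca' cb]] := cof_bound WO a th d' x ca d'th (fun j h => Ba _ (proj1 (xP j h))).
    have [y [By cy]] := Bc c ca'.
    exists (o i y); split; first exact: etaB.
    move=> j jd; have [Bx h] := xP j jd; apply: (le_lt WO) h _.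
    apply: oB => //; exact: (lt_le_tr WO) (cb j jd) cy.
have [da [di dc]] := dP eta ceta.
have dle z z' : lt z' th -> le z z' -> le (d eta z) (d eta z').
  by move=> h [h'|->]; [left; exact: di|right].
split=> //; exists (fun x => B x /\ Phi i eta x).
split; first by move=> x [/Ba].
split.
  move=> b ba; have [x [Bx bx]] := Bc b ba.
  have [z [zth xz]] := dc (o i x) (etaB x Bx).
  have [y [[By zy] yl]] : exists y, (B y /\ le (d eta z) (o i y)) /\
      forall y', (B y' /\ le (d eta z) (o i y')) -> le y y'.
    apply: (least WO); exact: etac _ (da z zth).
  exists y; split.
    split=> //; exists z; split=> //; split=> // y' ty'.
    have y'y : lt y' y by case: ty'.
    case: (le_or_lt WO (d eta z) (o i y')) => // h.
    exfalso; apply: (le_nlt WO y' y) y'y; apply: yl; split=> //; exact/(coh y y' By (proj1 ty')).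
  apply: (le_tr WO) bx _; apply: (nlt_le WO) => yx.
  apply: (lt_irr WO (o i y)); apply: (lt_le_tr WO) (oB y x By Bx yx) _.
  exact: (le_tr WO) xz zy.
split.
  move=> g ga em; have [x0 [Bx0 gx0]] := Bc g ga.
  have [z0 [z0th h0]] := dc _ (etaB x0 Bx0).
  apply: (card_nemb th z0 cth z0th); apply: emb_trans em _.
  apply: (emb_cover lam _ _ (fun z x => B x /\ le (d eta z) (o i x) /\
      forall y, trace i x y -> lt (o i y) (d eta z))).
    move=> x [[Bx [z [zth [h1 h2]]]] xg]; exists z; split=> //.
    case: (le_or_lt WO z0 z) => // z0z; case: (lt_irr WO (o i x)).
    apply: (lt_le_tr WO) h1; apply: (lt_le_tr WO) (dle _ _ zth z0z); apply: (lt_le_tr WO) h0.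
    apply: oB => //; exact: (lt_le_tr WO) xg gx0.
  move=> z x x' [Bx [h1 h2]] [Bx' [h1' h2']].
  case: (lt_tri WO x x') => [l|[//|l]].
    have l' : trace i x' x by apply/(coh x' x Bx' l).
    by case: (le_nlt WO _ _ h1 (h2' x l')).
  have l' : trace i x x' by apply/(coh x x' Bx l).
  by case: (le_nlt WO _ _ h1' (h2 x' l')).
move=> g ga.
(* With [s] the first point of the trace from [g] on, the trace of [s] is exactly the part of [B]
   below [g]. *)
have [s [[Bs gs] sl]] : exists s, (B s /\ le g s) /\ forall s', (B s' /\ le g s') -> le s s'.
  apply: (least WO); exact: Bc.
have [k [kl kE]] := GP i eta il etalam.
exists s, k; split; first exact: Ba.
split=> // x; rewrite kE /=; split=> [[[Bx Px] xg]|[tx Px]].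
  by split=> //; apply/(coh s x Bs) => //; exact: (lt_le_tr WO) xg gs.
have xs : lt x s by case: tx.
have Bx : B x by apply/(coh s x Bs xs).
split=> //; case: (le_or_lt WO g x) => // gx; exfalso; apply: (le_nlt WO x s) xs; exact: sl.
Qed.

End SuccessorOfTheta.
End Approachable.
End Traces.

(** * Approachable points: club guessing *)

Section Guessing.
Context {O : Type} {lt : O -> O -> Prop} (WO : well_order lt).
Local Notation le := (Defs.le lt).
Local Notation seg := (Defs.seg lt).
Local Notation succ_of := (succ_of (lt := lt)).
Local Notation club_in := (club_in (lt := lt)).
Section Approachable.
Context {lam th : O} (clam : is_cardinal lt lam) (ilam : inf (seg lam)).
Context (slam : succ_of (fun _ => True) lam).
Context (cth : is_cardinal lt th) (ith : inf (seg th)) (rth : is_cof lt th th).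
Context (thlam : lt th lam).

Lemma emb_succ nu sg : succ_of (seg sg) nu -> emb (seg nu) (seg sg).
Proof.
move=> [_ [_ [_ n]]]; case: (emb_total WO (seg nu) (seg sg) sg (seg_closed WO nu)) => // -[b [bnu e]].
by case: n; apply: emb_trans e _; apply: (emb_seg WO); left.
Qed.

Lemma cof_limit_point (P : O -> Prop) nu (E : O -> Prop) : succ_of P nu ->
  emb (seg th) (seg nu) -> club_in P E ->
  exists a, P a /\ is_cof lt a th /\
    forall b, lt b a -> exists x, E x /\ lt b x /\ lt x a.
Proof.
move=> HP thnu [uE _]; have [cP _] := HP.
have [w wP] : exists w, forall z, lt z th -> E (w z) /\ P (w z) /\ forall z', lt z' z -> lt (w z') (w z).
  apply: (rec_choice lt th (fun z w y => lt z th -> E y /\ P y /\ forall z', lt z' z -> lt (w z') y)).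
    exact: (lt_wf WO).
    move=> z w w' y e h /h [h1 [h2 h3]]; split=> //; split=> // z' l; rewrite -e //; exact: h3.
  move=> z w IH; case: (classic (lt z th)) => zth; last by exists z.
  have [b [Pb hb]] := succ_bound WO HP (seg z) w (emb_trans _ _ _ (emb_seg WO _ _ (lt_le _ _ zth)) thnu)
    (fun z' l => proj1 (proj2 (IH z' l (lt_tr WO _ _ _ l zth)))).
  have [y [Ey [Py by_]]] := uE b Pb.
  exists y => _; split=> //; split=> // z' l; exact: (lt_tr WO) (hb z' l) by_.
have [b [Pb hb]] := succ_bound WO HP (seg th) w thnu (fun z l => proj1 (proj2 (wP z l))).
have [a [wa al]] : exists a, (forall z, lt z th -> lt (w z) a) /\
    forall a', (forall z, lt z th -> lt (w z) a') -> le a a'.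
  by apply: (least WO); exists b.
have wc c : lt c a -> exists z, lt z th /\ le c (w z).
  move=> ca; apply: NNPP => N; apply: (le_nlt WO c a) ca; apply: al => z zth.
  case: (le_or_lt WO c (w z)) => // h; case: N; by exists z.
exists a; split; first by case: (al b hb) => [h|-> //]; exact: cP h.
split.
  apply: (increasing_cof WO rth w); split=> //; split=> // z z' z'th l.
  by case: (wP z' z'th) => _ [_ h]; exact: h.
move=> c /wc [z [zth cz]].
have [z' [zz' z'th]] := card_limit WO th cth ith z zth.
case: (wP z' z'th) => Ew [_ h]; exists (w z'); split=> //; split; last exact: wa.
by apply: (le_lt WO) cz _; exact: h.
Qed.

Section ClubGuessing.
Context {sg mu : O} (ssg : succ_of (seg sg) th) (smu : succ_of (seg mu) sg).

(** [dr x] is the supremum of [E] up to [x], a point of [E] by closure, or the bottom when [E] has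
    no point there. *)
Lemma drop_exists (E : O -> Prop) bot : (forall y, le bot y) -> club_in (seg mu) E ->
  exists dr : O -> O, forall x, lt x mu ->
    le (dr x) x /\ (E (dr x) \/ dr x = bot) /\ forall z, le z x -> E z -> le z (dr x).
Proof.
move=> botP [_ cE].
have K x : lt x mu -> exists y, le y x /\ (E y \/ y = bot) /\ forall z, le z x -> E z -> le z y.
  move=> xmu.
  have [y [yub yl]] : exists y, (forall z, le z x -> E z -> le z y) /\
      forall y', (forall z, le z x -> E z -> le z y') -> le y y'.
    by apply: (least WO); exists x.
  have yx : le y x by apply: yl.
  exists y; split=> //; split=> //.
  case: (classic (E y)) => Ey; first by left.
  case: (botP y) => [by_|->]; last by right.
  left; apply: cE; [exact: (le_lt WO) yx xmu|by exists bot|].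
  move=> b bly; apply: NNPP => N; apply: (le_nlt WO b y) bly; apply: yl => z zx Ez.
  case: (le_or_lt WO z b) => // bz; case: N; exists z; split=> //; split=> //.
  by case: (yub z zx Ez) => // Ezy; case: Ey; rewrite -Ezy.
have [dr drP] := choice_on mu _ _ K.
by exists dr.
Qed.

Definition guesses (c C : O -> Prop) (a : O) : Prop :=
  (forall x, c x -> lt x a /\ C x) /\ cofinal_in lt c a /\
  forall g, lt g a -> ~ emb (seg th) (fun x => c x /\ lt x g).

(* If no sequence guesses, shrink clubs [sg] times, each club avoiding the guesses obtained
   by dropping a fixed ladder into the previous one.  The dropped values decrease, so on one
   ladder of length [th] < [sg] they all stabilise before [sg]: a contradiction. *)
Theorem club_guessing : exists c : O -> O -> Prop, forall C, club_in (seg mu) C ->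
  exists a, lt a mu /\ is_cof lt a th /\ guesses (c a) C a.
Proof.
have [bot [_ botP0]] : exists x : O, True /\ forall y, True -> le x y.
  by apply: (least WO); exists mu.
have botP y : le bot y by exact: botP0.
have [dr drP] := choice_on (fun x => x) _ _ (fun E h => drop_exists E bot botP h).
have [s sP] := choice_on (fun x => x) _ _ (fun a (h : is_cof lt a th) => cof_increasing WO a h).
(* The ladder at [a] dropped into [E]; the bottom is left out as it need not belong to [E]. *)
pose c E a y := y <> bot /\ exists z, lt z th /\ y = dr E (s a z).
have cP E a : club_in (seg mu) E -> lt a mu -> is_cof lt a th ->
    (forall b, lt b a -> exists x, E x /\ lt b x /\ lt x a) ->
    forall C, (forall y, c E a y -> C y) -> guesses (c E a) C a.
  move=> clE amu ca lE C cC; have [sa [si sc]] := sP a ca.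
  have smu' z : lt z th -> lt (s a z) mu by move=> /sa h; exact: (lt_tr WO) h amu.
  split.
    move=> y cy; split; last exact: cC.
    case: cy => _ [z [zth ->]]; case: (drP E clE _ (smu' z zth)) => h _.
    exact: (le_lt WO) h (sa z zth).
  split.
    move=> b ba; have [x [Ex [bx xa]]] := lE b ba.
    have [z [zth xz]] := sc x xa.
    have xd : le x (dr E (s a z)) by case: (drP E clE _ (smu' z zth)) => _ [_]; exact.
    exists (dr E (s a z)); split; last by left; exact: (lt_le_tr WO) bx xd.
    split; last by exists z.
    move=> e; apply: (le_nlt WO b bot (botP b)); rewrite -e; exact: (lt_le_tr WO) bx xd.
  move=> g ga em; have [x [Ex [gx xa]]] := lE g ga.
  have [z0 [z0th xz0]] := sc x xa.
  apply: (card_nemb th z0 cth z0th); apply: emb_trans em _.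
  apply: (emb_image lam _ (fun z => dr E (s a z))) => y [[_ [z [zth ->]]] yg].
  exists z; split=> //; case: (le_or_lt WO z0 z) => // z0z.
  case: (lt_irr WO x); apply: (le_lt WO) _ ((lt_tr WO) _ _ _ yg gx).
  case: (drP E clE _ (smu' z zth)) => _ [_ h]; apply: h => //.
  apply: (le_tr WO) xz0 _; case: z0z => [l|->]; [left; exact: si|exact: le_refl].
apply: NNPP => N.
(* [D E] is a club refuting the guesses made from [E]; then [E i] is the intersection of all
   [D (E j)] with [j < i]. *)
have K E : True -> exists D, club_in (seg mu) D /\ forall a, lt a mu -> is_cof lt a th -> ~ guesses (c E a) D a.
  move=> _; apply: NNPP => M; apply: N; exists (c E) => C clC.
  apply: NNPP => M'; apply: M; exists C; split=> // a amu ca g; apply: M'; by exists a.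
have [D DP] := choice_on (fun _ => True) _ _ K.
have clD E : club_in (seg mu) (D E) by case: (DP E I).
have [E EP] : exists E : O -> O -> Prop, forall i, forall x, E i x <-> forall j, lt j i -> D (E j) x.
  apply: (rec_choice lt (fun _ => True) (fun i E y => forall x, y x <-> forall j, lt j i -> D (E j) x)).
    exact: (lt_wf WO).
    move=> i E E' y e H x; split=> [/H h j ji|h]; first by rewrite -e //; exact: h.
    by apply/H => j ji; rewrite e //; exact: h.
  by move=> i E _; exists (fun x => forall j, lt j i -> D (E j) x).
have clI i : le i sg -> club_in (seg mu) (fun x => forall j, seg i j -> D (E j) x).
  move=> isg; apply: (club_inter WO smu) => //; exact: (emb_seg WO).
have clE i : lt i sg -> club_in (seg mu) (E i).
  move=> isg; have [u cl] := clI i (lt_le i sg isg); split.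
    move=> b /u [x [h h']]; exists x; split=> //; exact/EP.
  move=> a amu na H; apply/EP; apply: cl => // b /H [x [/EP h h']]; by exists x.
have Emono i j x : lt i j -> E j x -> E i x.
  move=> ij /EP h; apply/EP => k ki; apply: h; exact: (lt_tr WO) ki ij.
have [a [amu [ca lE]]] := cof_limit_point _ _ _ smu (emb_succ _ _ ssg) (clI sg (le_refl _)).
have lEi i : lt i sg -> forall b, lt b a -> exists x, E i x /\ lt b x /\ lt x a.
  move=> isg b /lE [x [h h']]; exists x; split=> //; apply/EP => j ji; apply: h; exact: (lt_tr WO i j sg ji isg).
have [sa [si sc]] := sP a ca.
have smu' z : lt z th -> lt (s a z) mu by move=> /sa h; exact: (lt_tr WO) h amu.
have [i0 i0sg] : exists i, lt i sg.
  by case: smu => _ [[n [nsg _]] _]; exists (n 0); exact: nsg.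
have stab z : lt z th -> exists i, lt i sg /\ forall j, lt j sg -> lt i j ->
    dr (E j) (s a z) = dr (E i) (s a z).
  move=> zth; pose x := s a z.
  have [y [[i [isg Ey]] yl]] : exists y, (exists i, lt i sg /\ dr (E i) x = y) /\
      forall y', (exists i, lt i sg /\ dr (E i) x = y') -> le y y'.
    by apply: (least WO); exists (dr (E i0) x), i0.
  exists i; split=> // j jsg ij.
  have [h1 [h2 _]] := drP _ (clE j jsg) x (smu' z zth).
  have [_ [_ h]] := drP _ (clE i isg) x (smu' z zth).
  have l1 : le (dr (E j) x) (dr (E i) x).
    by case: h2 => [Ej|->]; [apply: h => //; exact: Emono Ej|].
  case: l1 => // l1; exfalso; apply: (le_nlt WO _ _ _ l1); rewrite Ey; apply: yl; by exists j.
have [ii iiP] := choice_on sg _ _ stab.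
have [i [isg hi]] := succ_bound WO ssg (seg th) ii (emb_incl _ _ (fun _ h => h)) (fun z h => proj1 (iiP z h)).
have [j [jsg ij]] := succ_gt WO ssg i isg.
have [_ /(_ a amu ca)] := DP (E i) I; apply.
apply: cP => //; [exact: clE|exact: lEi|].
move=> y [nbot [z [zth Ey]]].
have [iz iE] := iiP z zth.
(* Beyond [i] the dropped value no longer changes, so it lies in [E j], hence in [D (E i)]: the
   guess that [D (E i)] refutes succeeds. *)
have e1 : y = dr (E j) (s a z).
  by rewrite Ey (iE i isg (hi z zth)) (iE j jsg (lt_tr WO _ _ _ (hi z zth) ij)).
have [_ [Ej _]] := drP _ (clE j jsg) (s a z) (smu' z zth).
by move: Ej; rewrite -e1 => -[/EP|//]; apply.
Qed.

(** * A sequence reflecting the guesses *)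

Lemma lsub_exists : exists L : (O -> O) -> O -> O, forall f i,
  (forall j, lt j i -> lt (f j) (L f i)) /\
  (forall y, (forall j, lt j i -> lt (f j) y) -> le (L f i) y).
Proof.
have K (p : (O -> O) * O) : True -> exists y, (forall j, lt j (snd p) -> lt (fst p j) y) /\
    (forall y', (forall j, lt j (snd p) -> lt (fst p j) y') -> le y y').
  move=> _; apply: (least WO).
  have [y [_ h]] := succ_bound WO slam (seg (snd p)) (fst p) (emb_le_lam slam _) (fun _ _ => I).
  by exists y.
have [L LP] := choice_on lam _ _ K.
by exists (fun f i => L (f, i)) => f i; exact: (LP (f, i) I).
Qed.

(** The supremum [de] of the sequence [xi] has a fixed cofinal sequence [e de], and for a club of
    [i < mu] the two have the same supremum below [i]. A guess [c a] inside that club is thus known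
    to [de], and by reflection its initial segments are known to points below the limit [ga] of [xi]
    at [a]. *)
Lemma stationary_listed_guess : le mu lam -> exists Q, stationary lt (listed (lt := lt) (lam := lam) (th := th) Q).
Proof.
move=> mulam.
have [c cP] := club_guessing.
have [L LP] := lsub_exists.
have [G GP] := index_enum WO ilam thlam.
have Lub f i j : lt j i -> lt (f j) (L f i) by case: (LP f i) => h _; exact: h.
have Lle f i y : (forall j, lt j i -> lt (f j) y) -> le (L f i) y by case: (LP f i) => _ h; exact: h.
have Lcof f i y : lt y (L f i) -> exists j, lt j i /\ le y (f j).
  move=> yl; apply: NNPP => N; apply: (le_nlt WO _ _ _ yl); apply: Lle => j ji.
  case: (le_or_lt WO y (f j)) => // h; case: N; by exists j.
have Lle2 f f' i : (forall j, lt j i -> exists j', lt j' i /\ le (f j) (f' j')) -> le (L f i) (L f' i).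
  move=> H; apply: Lle => j /H [j' [j'i h]]; apply: (le_lt WO) h _; exact: Lub.
have Leq f f' i : (forall j, lt j i -> exists j', lt j' i /\ le (f j) (f' j')) ->
    (forall j, lt j i -> exists j', lt j' i /\ le (f' j) (f j')) -> L f i = L f' i.
  move=> H H'; case: (Lle2 f f' i H) => // l; exfalso; exact: (le_nlt WO _ _ (Lle2 f' f i H') l).
have Lext f f' i : (forall j, lt j i -> f j = f' j) -> L f i = L f' i.
  by move=> H; apply: Leq => j ji; exists j; split=> //; rewrite H //; exact: le_refl.
have Ke d : (exists f, (forall i, lt i mu -> lt (f i) d) /\ forall b, lt b d -> exists i, lt i mu /\ le b (f i)) ->
   exists f, (forall i, lt i mu -> lt (f i) d) /\ forall b, lt b d -> exists i, lt i mu /\ le b (f i) by [].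
have [e eP] := choice_on (fun x => x) _ _ Ke.
exists (fun s k x => exists i, c (fst (G k)) i /\ lt i (snd (G k)) /\ x = L (e s) i).
move=> E clE; have [uE ccE] := clE.
pose agree s f a i := forall j, lt j i -> c a j -> L (e s) j = L f j.
have [xi xiP] : exists xi, forall i, E (xi i) /\ (forall j, lt j i -> lt (xi j) (xi i)) /\
    forall a, lt a mu -> (exists s, agree s xi a i) -> exists s, lt s (xi i) /\ agree s xi a i.
  apply: (rec_choice lt lam (fun i xi y => E y /\ (forall j, lt j i -> lt (xi j) y) /\
    forall a, lt a mu -> (exists s, agree s xi a i) -> exists s, lt s y /\ agree s xi a i)).
    exact: (lt_wf WO).
    move=> i f f' y H [h1 [h2 h3]].
    have Lf j : lt j i -> L f j = L f' j.
      by move=> ji; apply: Lext => j' j'j; apply: H; exact: (lt_tr WO) j'j ji.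
    split=> //; split=> [j ji|a amu [s ag]]; first by rewrite -H //; exact: h2.
    have [|s' [s'y ag']] := h3 a amu; first by exists s => j ji cj; rewrite Lf //; exact: ag.
    by exists s'; split=> // j ji cj; rewrite -Lf //; exact: ag'.
  move=> i f _.
  (* For each of the at most [lam] indices [a], some [s] agreeing with the sequence so far is
     chosen, if there is one; the next point is put above all of them. *)
  have K a : lt a mu -> exists s, (exists s', agree s' f a i) -> agree s f a i.
    move=> _; case: (classic (exists s', agree s' f a i)) => [[s h]|n]; first by exists s.
    by exists lam.
  have [s sP] := choice_on lam _ _ K.
  have [y1 [_ h1]] := succ_bound WO slam (seg mu) s (emb_seg WO _ _ mulam) (fun _ _ => I).
  have [y2 [_ h2]] := succ_bound WO slam (seg i) f (emb_le_lam slam _) (fun _ _ => I).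
  have [m [m1 [m2 _]]] := max2 WO y1 y2.
  have [y [Ey my]] := uE m.
  exists y; split=> //; split.
    move=> j ji; apply: (lt_tr WO) my; exact: (lt_le_tr WO) (h2 j ji) m2.
  move=> a amu h; exists (s a); split; last exact: sP.
  apply: (lt_tr WO) my; exact: (lt_le_tr WO) (h1 a amu) m1.
have xiE i : E (xi i) by case: (xiP i).
have xi_lt j i : lt j i -> lt (xi j) (xi i) by case: (xiP i) => _ [h _]; exact: h.
have xi_le j i : le j i -> le (xi j) (xi i).
  by case=> [/xi_lt|->]; [left|right].
have Lxi i : le (L xi i) (xi i) by apply: Lle; move=> j; exact: xi_lt.
have Lmono i i' : le i i' -> le (L xi i) (L xi i').
  move=> ii'; apply: Lle => j ji; apply: Lub; exact: (lt_le_tr WO) ji ii'.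
pose de := L xi mu.
have [ed edc] := eP de (ex_intro _ xi (conj (fun i => Lub xi mu i) (fun b => Lcof xi mu b))).
(* By stage [k], each of the sequences [xi] and [e de] has reached the value of the other at [j]; at
   closure points of [g] their suprema agree. *)
have Kg j : lt j mu -> exists k, lt k mu /\
    (exists k', le k' k /\ le (xi j) (e de k')) /\ (exists k', le k' k /\ le (e de j) (xi k')).
  move=> jmu; have [k1 [k1mu h1]] := edc _ (Lub xi mu j jmu).
  have [k2 [k2mu h2]] := Lcof xi mu _ (ed j jmu).
  have [k [l1 [l2 kE]]] := max2 WO k1 k2.
  exists k; split; first by case: kE => ->.
  by split; [exists k1|exists k2].
have [g gP] := choice_on mu _ _ Kg.
have clC := club_closure WO smu (fun x => match excluded_middle_informative (lt x mu) with left _ => g x | right _ => x end).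
have [|a [amu [ca [cC [cc csm]]]]] := cP _ (clC _).
  move=> x xmu; case: (excluded_middle_informative (lt x mu)) => // h; by case: (gP x h).
have agr i : c a i -> L (e de) i = L xi i.
  move=> ci; have [ia clo] := cC i ci.
  have gi j : lt j i -> lt j mu /\ lt (g j) i.
    move=> ji; have jmu : lt j mu by apply: (lt_tr WO) ji _; exact: (lt_tr WO) ia amu.
    by split=> //; have := clo j ji; case: (excluded_middle_informative (lt j mu)).
  apply: Leq => j /gi [jmu gji]; case: (gP j jmu) => _ [[k1 [l1 h1]] [k2 [l2 h2]]].
    by exists k2; split=> //; exact: (le_lt WO) l2 gji.
  by exists k1; split=> //; exact: (le_lt WO) l1 gji.
have alim := cof_limit WO ith a ca.
pose ga := L xi a.
have belowga b : lt b ga -> exists j, lt j a /\ lt b (xi j) /\ lt b (L xi j).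
  move=> /Lcof [j [ja bj]]; have [j1 [jj1 j1a]] := alim j ja.
  exists j1; split=> //; split; first exact: (le_lt WO) bj (xi_lt _ _ jj1).
  exact: (le_lt WO) bj (Lub xi j1 j jj1).
exists ga; split; last first.
  apply: ccE.
    have [n [nth _]] := ith; have [f [fa _]] := cof_fun a th ca.
    exists (xi (f (n 0))); apply: Lub; apply: fa; exact: nth.
  by move=> b bga; have [j [ja [bj _]]] := belowga b bga; exists (xi j); split=> //; split=> //; exact: Lub.
split.
  have [s sP] := cof_increasing WO a ca; have [sa [si sc]] := sP.
  apply: (increasing_cof WO rth (fun z => xi (s z))); split.
    by move=> z zth; apply: Lub; exact: sa.
  split; first by move=> z z' z'th zz'; apply: xi_lt; exact: si.
  move=> b /Lcof [j [ja bj]]; have [z [zth jz]] := sc j ja.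
  exists z; split=> //; apply: (le_tr WO) bj _; exact: xi_le.
exists (fun x => exists i, c a i /\ x = L xi i).
split.
  move=> x [i [ci ->]]; apply: (le_lt WO) (Lxi i) _; apply: Lub; by case: (cC i ci).
split.
  move=> b /belowga [j [ja [_ bj]]]; have [i [ci ji]] := cc j ja.
  exists (L xi i); split; first by exists i.
  by left; apply: (lt_le_tr WO) bj _; exact: Lmono.
split.
  move=> y yga em; have [j [ja [_ yj]]] := belowga y yga.
  apply: (csm j ja); apply: emb_trans em _.
  apply: (emb_image lam _ (L xi)) => x [[i [ci ->]] iy]; exists i; split=> //; split=> //.
  case: (le_or_lt WO j i) => // ji; case: (lt_irr WO y).
  apply: (lt_tr WO) yj _; apply: (le_lt WO) _ iy; exact: Lmono.
move=> y yga.
have [j [ja [_ yj]]] := belowga y yga.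
(* At the least index [i] where the suprema reach [y], the values [L xi i'] below [y] are exactly
   those with [i' < i]. *)
have [i [yi il]] := least WO (fun i => le y (L xi i)) (ex_intro (fun i => le y (L xi i)) j (lt_le _ _ yj)).
have ia : lt i a by apply: (le_lt WO) ja; apply: il; left.
have [_ [_ /(_ a amu)]] := xiP i.
(* [de] itself agrees with [xi] on the guess, so reflection yields an agreeing [s] below [xi i],
   hence below [ga]. *)
case; first by exists de => j' _ cj'; exact: agr.
move=> s [si ag].
have [k [kl kE]] := GP a i (lt_le_tr WO _ _ _ amu mulam) (lt_tr WO _ _ _ ia (lt_le_tr WO _ _ _ amu mulam)).
exists s, k; split; first by apply: (lt_tr WO) si _; exact: Lub.
split=> // x; rewrite kE /=; split.
  move=> [[i' [ci' ->]] l]; exists i'; split=> //.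
  have i'i : lt i' i.
    case: (le_or_lt WO i i') => // h; case: (lt_irr WO y); apply: (le_lt WO) yi _.
    exact: (le_lt WO) (Lmono _ _ h) l.
  by split=> //; rewrite ag.
move=> [i' [ci' [i'i ->]]]; rewrite ag //; split; first by exists i'.
case: (le_or_lt WO y (L xi i')) => // h; exfalso; apply: (le_nlt WO _ _ _ i'i); exact: il.
Qed.

End ClubGuessing.

(** [sg] is theta^+. If it is below [lam], its successor [mu] is at most [lam] and club guessing
    applies; otherwise it equals [lam] and every point of cofinality [th] is listed. *)
Theorem stationary_listed : exists Q, stationary lt (listed (lt := lt) (lam := lam) (th := th) Q).
Proof.
have [sg [csg [ssg sgl]]] := succ_exists WO th lam ith (card_nemb _ _ clam thlam).
have [e0 e0P] := choice_on (fun _ => lam) (fun _ => True) _ (fun d _ => emb_le_lam slam d).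
case: sgl => [sgl|E].
  have isg : inf (seg sg).
    exact: emb_trans ith (emb_succ _ _ ssg).
  have [mu [_ [smu mul]]] := succ_exists WO sg lam isg (card_nemb _ _ clam sgl).
  exact: stationary_listed_guess ssg smu mul.
subst sg.
have [Q QP] := stationary_listed_succ WO ilam cth ith thlam ssg e0
  (fun d x h => proj1 (e0P d I) x h) (fun d x y h h' => proj2 (e0P d I) x y h h').
exists Q => C clC; have [_ clos] := clC.
have clC' : club_in (fun _ => True) C by apply/club_club_in.
have [a [_ [ca lC]]] := cof_limit_point _ _ _ slam (emb_seg WO _ _ (lt_le _ _ thlam)) clC'.
exists a; split; first exact: QP.
apply: clos => //; have [n [nth _]] := ith; have [f [fa _]] := cof_fun a th ca.
exists (f (n 0)); apply: fa; exact: nth.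
Qed.

End Approachable.
End Guessing.

(** * The cycle of implications *)

Theorem theorem3p7 (O : Type) (lt : O -> O -> Prop) (lam th ch : O) :
  well_order lt ->
  is_cardinal lt lam -> infinite lt lam ->
  is_succ_card_of lt lam ->
  is_cardinal lt th -> infinite lt th -> is_cof lt th th ->
  (is_two lt ch \/ (is_cardinal lt ch /\ infinite lt ch)) ->
  le lt ch th -> lt th lam ->
  ~ is_cof lt lam th ->
  let P1 := forall S : O -> Prop, I_ideal lt S ->
              (forall a, S a -> E_cof lt th a) -> J_ideal lt ch S in
  let P2 := exists S : O -> Prop, (forall a, S a -> E_cof lt th a) /\
              stationary lt S /\ J_ideal lt ch S in
  let P3 := m_is lt (seg lt th) lam th ch lam in
  let P4 := m_is lt (seg lt lam) lam th ch lam in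
  (P1 <-> P2) /\ (P2 <-> P3) /\ (P3 <-> P4).
Proof.
move=> WO clam /inf_infinite ilam [_ [lelam nle]] cth /inf_infinite ith rth _ chth thlam ncof P1 P2 P3 P4.
have slam : succ_of (lt := lt) (fun _ => True) lam.
  split=> //; split=> //; split=> [b _|h]; first by apply: (le_card_emb lam); exact: lelam.
  by apply: nle; exact: emb_le_card.
have e3 : P3 <-> small_family (lt := lt) (lam := lam) (th := th) (ch := ch) (seg lt th).
  exact: (m_is_small WO clam ith chth thlam).
have e4 : P4 <-> small_family (lt := lt) (lam := lam) (th := th) (ch := ch) (seg lt lam).
  by apply: (m_is_small WO clam ith chth thlam) => x h; apply: (lt_tr WO) h thlam.
have p12 : P1 -> P2.
  move=> p1; have [Q st] := stationary_listed WO clam ilam slam cth ith rth thlam.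
  have Qth a : listed (lt := lt) (lam := lam) (th := th) Q a -> E_cof lt th a by case.
  exists (listed (lt := lt) (lam := lam) (th := th) Q); split=> //; split=> //.
  by apply: p1 => //; exact: (listed_I WO).
have p23 : P2 -> P3.
  by move=> [S [Sth [St SJ]]]; apply/e3; exact: (J_small_family WO slam cth ith rth S).
have p34 : P3 -> P4.
  by move/e3 => h; apply/e4; exact: (small_family_lift WO).
have p41 : P4 -> P1.
  by move/e4 => h S SI Sth; exact: (approachable_J WO clam ilam slam cth ith rth thlam ncof).
by split; [|split]; split; auto.
Qed.
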